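(* Let $X$ be any one of the spaces $H^2$, $\mathcal{B}$, $BMOA$, and let $g$ be an analytic function on $D$ such that $T_g$ is a bounded operator on $X$. Then $T_g$ is not bounded below on $X$.
   Context: $D$ is the open unit disk in $\mathbb{C}$ and $H(D)$ is the set of analytic functions on $D$. For $g\in H(D)$, $T_g f(z) = \int_0^z f(w) g'(w)\, dw$. The Hardy space is $H^2 = \{f\in H(D): \|f\|_{2}^2 = \sup_{0<r<1}\int_0^{2\pi}|f(re^{it})|^2 dt < \infty\}$. The Bloch space is $\mathcal{B} = \{f \in H(D) : \|f\|_{\mathcal{B}} = \sup_{z\in D} |f'(z)|(1-|z|^2) < \infty\}$; $\|\cdot\|_{\mathcal{B}}$ is a seminorm, and the norm on $\mathcal{B}$ is $|f(0)| + \|f\|_{\mathcal{B}}$. For an arc $I\subseteq\partial D$ of length $|I|$, $S(I) = \{re^{i\theta} : 1-|I| < r < 1,\ e^{i\theta}\in I\}$ (with $r \ge 0$). A measure $\mu$ on $D$ is a Carleson measure if there is $C>0$ with $\mu(S(I)) \le C|I|$ for all arcs $I \subseteq \partial D$; the smallest such $C$ is its Carleson constant. For $f\in H(D)$ let $d\mu_f(z) = |f'(z)|^2(1-|z|^2)\,dA(z)$, where $dA$ is Lebesgue area measure. $BMOA$ is the set of $f \in H(D)$ for which $\mu_f$ is a Carleson measure, with norm (up to equivalence) $|f(0)| + \|f\|_*$, where $\|f\|_*$ is the square root of the Carleson constant of $\mu_f$. An operator $T$ on a normed space is bounded below if there exists $C>0$ such that $\|Tf\| \ge C\|f\|$ for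 all $f$ in the space. *)

(* Defs.v *)
From HB Require Import structures.
From mathcomp Require Import all_boot all_order all_algebra.
From mathcomp Require Import complex.
From mathcomp Require Import all_classical all_reals all_analysis.

Set Implicit Arguments.
Unset Strict Implicit.
Unset Printing Implicit Defensive.

Import Order.TTheory GRing.Theory Num.Theory.
Import numFieldNormedType.Exports.

Local Open Scope classical_set_scope.
Local Open Scope ring_scope.
Local Open Scope complex_scope.

(* The topology of the regular module over the field R[i]. *)
HB.instance Definition _ (R : realType) := GRing.ComAlgebra.copy R[i] R[i]^o.
HB.instance Definition _ (R : realType) := Vector.copy R[i] R[i]^o.
HB.instance Definition _ (R : realType) := NormedModule.copy R[i] R[i]^o.

(* A function on the disk is represented by a total function R[i] -> R[i];
   every notion below depends only on its values on the disk. *)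

Definition disk (R : realType) : set R[i] := [set z | `|z| < 1].

(* The norm of R[i] takes its values in R[i]; this is the real modulus. *)
Definition modulus (R : realType) (z : R[i]) : R := complex.Re `|z|.

Definition expi (R : realType) (t : R) : R[i] := cos t +i* sin t.

(* Analyticity: a convergent power series expansion near every point. *)
Definition analytic_on_disk (R : realType) (f : R[i] -> R[i]) : Prop :=
  forall z0 : R[i], disk z0 ->
    exists2 rho : R, 0 < rho &
      exists a : nat -> R[i], forall z : R[i], modulus (z - z0) < rho ->
        series (fun n => a n * (z - z0) ^+ n) @ \oo --> f z.

(* Integral of h along the segment from 0 to z, through w = t z, 0 <= t <= 1. *)
Definition segment_integral (R : realType) (h : R[i] -> R[i]) (z : R[i])
    : R[i] :=
  \int[@lebesgue_measure R]_(t in `[0, 1]) complex.Re (h (t%:C * z) * z)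
  +i* \int[@lebesgue_measure R]_(t in `[0, 1]) complex.Im (h (t%:C * z) * z).

Definition Tg (R : realType) (g f : R[i] -> R[i]) : R[i] -> R[i] :=
  segment_integral (fun w => f w * derive1 g w).

Record function_space (R : realType) := FunctionSpace {
  carrier : set (R[i] -> R[i]);
  fnorm : (R[i] -> R[i]) -> R
}.

Definition hardy_norm2 (R : realType) (f : R[i] -> R[i]) : \bar R :=
  ereal_sup [set (\int[@lebesgue_measure R]_(t in `[0%R, (2 * pi)%R])
                    (modulus (f (r%:C * expi t)) ^+ 2)%:E)%E
            | r in [set r : R | 0 < r < 1]].

Definition H2 (R : realType) : function_space R := {|
  carrier := [set f | analytic_on_disk f /\ (hardy_norm2 f < +oo)%E];
  fnorm := fun f => Num.sqrt (fine (hardy_norm2 f))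
|}.

Definition bloch_seminorm (R : realType) (f : R[i] -> R[i]) : \bar R :=
  ereal_sup [set (modulus (derive1 f z) * (1 - modulus z ^+ 2))%:E
            | z in @disk R].

Definition Bloch (R : realType) : function_space R := {|
  carrier := [set f | analytic_on_disk f /\ (bloch_seminorm f < +oo)%E];
  fnorm := fun f => modulus (f 0) + fine (bloch_seminorm f)
|}.

(* I is an arc of the unit circle (with or without its endpoints) of length
   l, the full circle being allowed. *)
Definition is_arc (R : realType) (I : set R[i]) (l : R) : Prop :=
  exists (a : R) (b1 b2 : bool), [/\ 0 < l, l <= 2 * pi &
    I = [set expi t | t in [set` Interval (BSide b1 a) (BSide b2 (a + l))]]].

Definition carleson_box (R : realType) (I : set R[i]) (l : R) : set R[i] :=
  [set z | exists r t : R,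
     [/\ 0 <= r, 1 - l < r, r < 1, I (expi t) & z = r%:C * expi t]].

(* Below, a measure mu on the disk is given by its values on subsets of the
   plane; only those on Carleson boxes matter. *)
Definition carleson_bound (R : realType) (mu : set R[i] -> \bar R) (C : R)
    : Prop :=
  0 < C /\ forall (I : set R[i]) (l : R), is_arc I l ->
    (mu (carleson_box I l) <= (C * l)%:E)%E.

Definition is_carleson (R : realType) (mu : set R[i] -> \bar R) : Prop :=
  exists C : R, carleson_bound mu C.

(* An infimum, since the zero measure has no smallest C > 0. *)
Definition carleson_constant (R : realType) (mu : set R[i] -> \bar R) : R :=
  inf [set C | carleson_bound mu C].

(* The measure |f'(z)|^2 (1 - |z|^2) dA(z) on the disk, the plane being
   identified with R * R. *)
Definition mu_deriv (R : realType) (f : R[i] -> R[i]) (A : set R[i])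
    : \bar R :=
  (\int[(@lebesgue_measure R) \x (@lebesgue_measure R)]_(p in
      [set p : R * R | (A `&` @disk R) (p.1 +i* p.2)%C])
    (modulus (derive1 f (p.1 +i* p.2)%C) ^+ 2
     * (1 - modulus (p.1 +i* p.2)%C ^+ 2))%:E)%E.

Definition BMOA (R : realType) : function_space R := {|
  carrier := [set f | analytic_on_disk f /\ is_carleson (mu_deriv f)];
  fnorm := fun f =>
    modulus (f 0) + Num.sqrt (carleson_constant (mu_deriv f))
|}.

Definition bounded_on (R : realType) (X : function_space R)
    (T : (R[i] -> R[i]) -> (R[i] -> R[i])) : Prop :=
  (forall f, carrier X f -> carrier X (T f)) /\
  exists C : R, forall f, carrier X f -> fnorm X (T f) <= C * fnorm X f.

Definition bounded_below_on (R : realType) (X : function_space R)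
    (T : (R[i] -> R[i]) -> (R[i] -> R[i])) : Prop :=
  exists2 C : R, 0 < C &
    forall f, carrier X f -> C * fnorm X f <= fnorm X (T f).

(* Main.v *)
Require Import Defs.
From HB Require Import structures.
From mathcomp Require Import all_boot all_order all_algebra.
From mathcomp Require Import complex.
From mathcomp Require Import all_classical all_reals all_analysis.
From mathcomp Require Import measurable_realfun.
From mathcomp Require Import ring lra.
Import Order.TTheory GRing.Theory Num.Theory.
Import numFieldNormedType.Exports.

Set Implicit Arguments.
Unset Strict Implicit.
Unset Printing Implicit Defensive.
Local Open Scope classical_set_scope.
Local Open Scope ring_scope.
Local Open Scope complex_scope.

(** The proof compares T_g on the monomials z^n, whose norms are bounded below in
    each of the three spaces, with T_g on functions adapted to g. The link is the
    identity (T_g f)' = f g' ([derive1_Tg]): T_g z^n has derivative z^n g', which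
    is small compared with g' except near the unit circle.

    In H^2 the functions T_g z^n tend to 0. Let M_n (r) be the integral of
    |T_g z^n|^2 over the circle of radius r. By the Hardy-Stein identity
    ([is_derive_radial_mean]) the derivative of r M_n' (r) is 4 r times the
    integral of |z^n g'|^2 over that circle. Comparing this for n and for 0 gives
    M_n' <= r^(2n) M_0', whence
    M_n (r) <= s^(2n) M_0 (s) + (M_0 (r) - M_0 (s)) for s <= r
    ([mean_square_comparison]). Since T_g 1 belongs to H^2, M_0 is bounded, and
    the right-hand side is uniformly small for s close to 1 and n large.

    In the Bloch space and in BMOA, a lower bound for T_g on the z^n only shows
    that g does not decay at the circle: there are points z arbitrarily close to
    it with |g'(z)| (1 - |z|^2) > e, respectively arbitrarily short arcs of length
    l with mu_g (S(I)) > k l. For BMOA this uses that mu_g is finite, so that the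
    measures |z|^(2n) mu_g have masses tending to 0 ([weighted_tail_small]).
    Boundedness of T_g then fails on the partial sums L_N of -log (1 - u z)
    ([log_poly]), where the unit complex number u puts the singularity near the
    point or the arc in question. There |L_N| is close to the harmonic sum of N
    terms. On the other hand the Bloch norm of L_N is at most 2
    ([bloch_log_poly]), and its squared BMOA norm is O(log N)
    ([carleson_log_poly]), which is negligible with respect to the square of the
    harmonic sum: |L_N'|^2 has integral O(log N) over the disk, and 1 - |z|^2 is
    at most 2 l on a Carleson box over an arc of length l. *)

(** * Modulus, real and imaginary parts *)

Notation Re := complex.Re.
Notation Im := complex.Im.

Section modulus_theory.
Variable R : realType.
Implicit Types (z w : R[i]) (x y e t : R).

Lemma modulusE z : modulus z = Num.sqrt (Re z ^+ 2 + Im z ^+ 2).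
Proof. by case: z. Qed.

Lemma normc_modulus z : `|z| = (modulus z)%:C.
Proof. by case: z. Qed.

Lemma modulus_ge0 z : 0 <= modulus z.
Proof. by rewrite modulusE sqrtr_ge0. Qed.

Lemma sqr_modulus z : modulus z ^+ 2 = Re z ^+ 2 + Im z ^+ 2.
Proof. by rewrite modulusE sqr_sqrtr// addr_ge0// sqr_ge0. Qed.

Lemma modulusM z w : modulus (z * w) = modulus z * modulus w.
Proof. by apply: complexI; rewrite rmorphM -!normc_modulus normrM. Qed.

Lemma modulusD z w : modulus (z + w) <= modulus z + modulus w.
Proof. by rewrite -lecR rmorphD/= -!normc_modulus ler_normD. Qed.

Lemma modulusN z : modulus (- z) = modulus z.
Proof. by apply: complexI; rewrite -!normc_modulus normrN. Qed.

Lemma modulusB z w : modulus (z - w) = modulus (w - z).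
Proof. by rewrite -modulusN opprB. Qed.

Lemma modulus0 : @modulus R 0 = 0.
Proof. by apply: complexI; rewrite -!normc_modulus normr0. Qed.

Lemma modulus1 : @modulus R 1 = 1.
Proof. by apply: complexI; rewrite -!normc_modulus normr1. Qed.

Lemma modulus_eq0 z : (modulus z == 0) = (z == 0).
Proof.
by rewrite -(inj_eq (@complexI R)) -normc_modulus normr_eq0.
Qed.

Lemma modulusX z n : modulus (z ^+ n) = modulus z ^+ n.
Proof. by elim: n => [|n IH]; rewrite ?modulus1// !exprS modulusM IH. Qed.

Lemma modulusV z : modulus z^-1 = (modulus z)^-1.
Proof. by apply: complexI; rewrite fmorphV -!normc_modulus normfV. Qed.

Lemma modulusR x : modulus x%:C = `|x|.
Proof. by rewrite modulusE/= expr0n addr0 sqrtr_sqr. Qed.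

Lemma modulus_nat n : @modulus R n%:R = n%:R.
Proof. by rewrite -(rmorph_nat (real_complex R)) modulusR ger0_norm. Qed.

Lemma modulus_expi t : modulus (expi t) = 1.
Proof. by rewrite modulusE/= cos2Dsin2 sqrtr1. Qed.

Lemma modulus_polar x t : 0 <= x -> modulus (x%:C * expi t) = x.
Proof. by move=> x0; rewrite modulusM modulusR modulus_expi mulr1 ger0_norm. Qed.

Lemma modulus_conj z : modulus z^* = modulus z.
Proof. by rewrite !modulusE; case: z => a b /=; rewrite sqrrN. Qed.

Lemma le_Re_modulus z : `|Re z| <= modulus z.
Proof.
by rewrite -sqrtr_sqr modulusE ler_wsqrtr// lerDl sqr_ge0.
Qed.

Lemma le_Im_modulus z : `|Im z| <= modulus z.
Proof.
by rewrite -sqrtr_sqr modulusE ler_wsqrtr// lerDr sqr_ge0.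
Qed.

Lemma modulus_ReIm z : modulus z <= `|Re z| + `|Im z|.
Proof.
have -> : z = (Re z)%:C + 'i%C * (Im z)%:C by rewrite -complexE.
apply: le_trans (modulusD _ _) _.
rewrite modulusM !modulusR modulusE/= expr0n add0r expr1n sqrtr1 mul1r.
by case: z => a b /=; rewrite !mul0r !mul1r !subr0 !add0r !addr0.
Qed.

Lemma modulus_lowerB z w : modulus z - modulus w <= modulus (z - w).
Proof. by rewrite lerBlDr -[X in modulus X <= _](subrK w) modulusD. Qed.

Lemma modulus_sum (I : Type) (s : seq I) (F : I -> R[i]) :
  modulus (\sum_(i <- s) F i) <= \sum_(i <- s) modulus (F i).
Proof.
elim: s => [|i s IH]; first by rewrite !big_nil modulus0.
by rewrite !big_cons (le_trans (modulusD _ _))// lerD2l.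
Qed.

Lemma diskP z : disk z <-> modulus z < 1.
Proof. by rewrite /disk/= normc_modulus (_ : 1 = 1%:C)// ltcR. Qed.

Lemma ReD z w : Re (z + w) = Re z + Re w. Proof. by case: z w => [??] []. Qed.
Lemma ImD z w : Im (z + w) = Im z + Im w. Proof. by case: z w => [??] []. Qed.
Lemma ReN z : Re (- z) = - Re z. Proof. by case: z. Qed.
Lemma ImN z : Im (- z) = - Im z. Proof. by case: z. Qed.
Lemma ReM z w : Re (z * w) = Re z * Re w - Im z * Im w.
Proof. by case: z w => [??] []. Qed.
Lemma ImM z w : Im (z * w) = Re z * Im w + Im z * Re w.
Proof. by case: z w => [??] []. Qed.

Lemma ReZ x z : Re (x%:C * z) = x * Re z.
Proof. by rewrite ReM/= mul0r subr0. Qed.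
Lemma ImZ x z : Im (x%:C * z) = x * Im z.
Proof. by rewrite ImM/= mul0r addr0. Qed.

(** The norm of [R[i]] is itself complex valued; the next lemmas trade its
    complex radii for real ones. *)
Lemma gt0_complexP (e : R[i]) : 0 < e -> exists2 d : R, 0 < d & e = d%:C.
Proof.
by case: e => a b; rewrite ltcE/= => /andP[/eqP -> a0]; exists a.
Qed.

Lemma cvg_complexP (u : nat -> R[i]) l : u @ \oo --> l <->
  forall e, 0 < e -> exists N, forall n, (N <= n)%N -> modulus (u n - l) < e.
Proof.
split=> [/cvgrPdistC_lt ul e e0|ul].
  have /ul[N _ HN] : 0 < e%:C :> R[i] by rewrite ltcR.
  by exists N => n Nn; have := HN _ Nn; rewrite /= normc_modulus ltcR.
apply/cvgrPdistC_lt => _ /gt0_complexP[e e0 ->].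
have [N HN] := ul _ e0.
by exists N => // n Nn /=; rewrite normc_modulus ltcR HN.
Qed.

Lemma modulus_cvg_le (u : nat -> R[i]) l C : u @ \oo --> l ->
  (forall n, modulus (u n) <= C) -> modulus l <= C.
Proof.
move=> /cvg_complexP ul uC; apply/ler_addgt0Pr => e e0.
have [N /(_ N (leqnn _))] := ul _ e0; rewrite modulusB => /ltW h.
by rewrite addrC -lerBlDr (le_trans _ h)// (le_trans _ (modulus_lowerB _ _))// lerD2l lerN2.
Qed.

Lemma cvg_ReIm (u : nat -> R[i]) (a b : R) :
  (fun n => Re (u n)) @ \oo --> a -> (fun n => Im (u n)) @ \oo --> b ->
  u @ \oo --> a +i* b.
Proof.
move=> /cvgrPdistC_lt ua /cvgrPdistC_lt ub; apply/cvg_complexP => e e0.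
have e20 : 0 < e / 2 by rewrite divr_gt0.
have [N _ HN] := ua _ e20; have [M _ HM] := ub _ e20.
exists (maxn N M) => n; rewrite geq_max => /andP[Nn Mn].
rewrite (le_lt_trans (modulus_ReIm _))// [e]splitr ltrD//.
- by rewrite ReD ReN; exact: HN.
- by rewrite ImD ImN; exact: HM.
Qed.

End modulus_theory.

(** * Complex derivatives of power series *)

Lemma is_derive_epsP (K : numFieldType) (f : K -> K) (x d : K) :
  is_derive x 1 f d <-> forall e, 0 < e -> exists2 del, 0 < del &
    forall h, `|h| < del -> `|f (x + h) - f x - h * d| <= e * `|h|.
Proof.
have E h : h != 0 -> `|h^-1 *: (f (h *: 1 + x) - f x) - d| * `|h| =
    `|f (x + h) - f x - h * d|.
  move=> h0; rewrite -normrM mulrBl -[_ *: (_ - _)]/(_ * _) mulrAC mulVf//.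
  by rewrite mul1r -[h *: 1]/(h * 1) mulr1 [h + x]addrC [d * h]mulrC.
split=> [[fx dE]|H].
  move=> e e0; have : h^-1 *: (f (h *: 1 + x) - f x) @[h --> 0^'] --> d.
    by rewrite -dE.
  move=> /cvgrPdistC_le/(_ _ e0)[del /= del0 Hdel]; exists del => // h hd.
  have [->|h0] := eqVneq h 0; first by rewrite addr0 subrr mul0r subrr normr0 mulr0.
  rewrite -E// ler_pM2r ?normr_gt0//; apply: Hdel => //=.
  by rewrite sub0r normrN.
have cv : (h^-1 *: (f (h *: 1 + x) - f x)) @[h --> 0^'] --> d.
  apply/cvgrPdistC_le => e e0; have [del del0 Hdel] := H _ e0.
  exists del => //= h /=; rewrite sub0r normrN => hd h0.
  have hp : 0 < `|h| by rewrite normr_gt0.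
  by rewrite -(ler_pM2r hp) E// Hdel.
apply: DeriveDef; first by apply/cvg_ex; exists d.
by apply: cvg_lim => //; exact: norm_hausdorff.
Qed.

(** The error is measured with real moduli, so that complex derivatives can be
    composed with curves of a real parameter. *)
Definition has_cderiv (R : realType) (f : R[i] -> R[i]) (z d : R[i]) : Prop :=
  forall e : R, 0 < e -> exists2 del : R, 0 < del &
    forall h : R[i], modulus h < del ->
      modulus (f (z + h) - f z - h * d) <= e * modulus h.

Section complex_derivative.
Variable R : realType.
Implicit Types (f : R[i] -> R[i]) (z w h d : R[i]).

Lemma has_cderivP f z d : has_cderiv f z d <-> is_derive z (1 : R[i]) f d.
Proof.
split=> [fd|/is_derive_epsP fd e e0].
  apply/is_derive_epsP => _ /gt0_complexP[e e0 ->].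
  have [del del0 H] := fd _ e0; exists del%:C; first by rewrite ltcR.
  by move=> h; rewrite !normc_modulus ltcR -rmorphM lecR => /H.
have /fd[_ /gt0_complexP[del del0 ->] H] : 0 < e%:C :> R[i] by rewrite ltcR.
exists del => // h; have := H h.
by rewrite !normc_modulus ltcR -rmorphM lecR.
Qed.

Lemma has_cderiv_derive1 f z d : has_cderiv f z d -> derive1 f z = d.
Proof. by move=> /has_cderivP fd; rewrite derive1E derive_val. Qed.

Lemma has_cderiv_continuous f z d : has_cderiv f z d ->
  forall e : R, 0 < e -> exists2 del : R, 0 < del &
    forall w, modulus (w - z) < del -> modulus (f w - f z) < e.
Proof.
move=> fd e e0; have [del del0 H] := fd _ (@ltr01 R).
have C0 : 0 < 1 + modulus d by rewrite ltr_pwDl// modulus_ge0.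
exists (Num.min del (e / (1 + modulus d))).
  by rewrite lt_min del0 divr_gt0.
move=> w; rewrite lt_min => /andP[/H]; rewrite [z + _]addrC subrK => h1 h2.
rewrite ltr_pdivlMr// mulrC in h2; apply: le_lt_trans h2.
rewrite mulrDl [modulus d * _]mulrC -modulusM.
rewrite -[X in modulus X <= _](subrK ((w - z) * d)).
by rewrite (le_trans (modulusD _ _))// lerD.
Qed.

End complex_derivative.

Section power_series.
Variable R : realType.
Variables (z0 : R[i]) (rho : R) (a : nat -> R[i]) (f : R[i] -> R[i]).
Hypothesis rho0 : 0 < rho.
Hypothesis af : forall z : R[i], modulus (z - z0) < rho ->
  series (fun n => a n * (z - z0) ^+ n) @ \oo --> f z.

(* The radius r lies inside the disk of convergence, so a_n r^n is bounded; for
   |w| <= s = r / 8 the bound n < 2^n makes n^2 s^n / r^n at most 2^-n. *)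
Let r := rho / 2.
Let s := r / 8.
Let r0 : 0 < r. Proof. by rewrite divr_gt0. Qed.
Let s0 : 0 < s. Proof. by rewrite divr_gt0. Qed.
Let b n := n.+1%:R * a n.+1.

Let coef_bound : exists2 B : R, 0 < B & forall n, modulus (a n) * r ^+ n <= B.
Proof.
have zr : modulus (z0 + r%:C - z0) < rho.
  rewrite [z0 + _]addrC addrK modulusR ger0_norm ?ltW// /r.
  by rewrite ltr_pdivrMr// mulr_natr mulr2n ltrDl.
have /cvg_complexP/(_ _ ltr01)[N HN] :
    (fun n => a n * (z0 + r%:C - z0) ^+ n) @ \oo --> 0.
  apply: cvg_series_cvg_0.
  by apply/cvg_ex; exists (f (z0 + r%:C)); exact: af.
pose m n := modulus (a n) * r ^+ n.
have m0 n : 0 <= m n by rewrite mulr_ge0 ?modulus_ge0 ?exprn_ge0// ltW.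
exists (1 + \sum_(i < N) m i); first by rewrite ltr_pwDl// sumr_ge0.
move=> n; case: (ltnP n N) => nN.
  by rewrite (bigD1 (Ordinal nN))//= addrCA lerDl addr_ge0// sumr_ge0.
have := HN n nN; rewrite [z0 + _]addrC addrK subr0 modulusM modulusX modulusR.
rewrite ger0_norm ?(ltW r0)// => /ltW h; rewrite (le_trans h)//.
by rewrite lerDl sumr_ge0.
Qed.

(** The remainder e_n satisfies e_(n+1) = (w + h) e_n + n w^(n-1) h^2. *)
Let taylor_remainder (w h : R[i]) n : modulus w <= s -> modulus (w + h) <= s ->
  s ^+ 2 * modulus ((w + h) ^+ n - w ^+ n - n%:R * w ^+ n.-1 * h) <=
  n%:R ^+ 2 * s ^+ n * modulus h ^+ 2.
Proof.
move=> ws whs; elim: n => [|n IH].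
  by rewrite !expr0 subrr !mul0r subrr modulus0 mulr0 expr0n/= !mul0r.
set e := _ - _ in IH.
have -> : (w + h) ^+ n.+1 - w ^+ n.+1 - n.+1%:R * w ^+ n.+1.-1 * h =
   (w + h) * e + n%:R * w ^+ n.-1 * h ^+ 2.
  rewrite /e !exprS -natr1; case: n {IH e} => [|n] /=.
    by rewrite !expr0; ring.
  by rewrite !exprS; ring.
have n1 : s ^+ 2 * (n%:R * modulus w ^+ n.-1) <= n%:R * s ^+ n.+1.
  case: n {IH e} => [|n] /=; first by rewrite !mul0r mulr0.
  rewrite mulrCA ler_wpM2l// -[n.+2]addn2 exprD mulrC.
  by rewrite ler_wpM2r ?sqr_ge0// lerXn2r// nnegrE ?modulus_ge0// ltW.
have h0 := modulus_ge0 h.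
apply: le_trans (_ : s * (n%:R ^+ 2 * s ^+ n * modulus h ^+ 2) +
   n%:R * s ^+ n.+1 * modulus h ^+ 2 <= _); last first.
  rewrite -subr_ge0 -natr1 !exprS expr0 mulr1.
  rewrite [leRHS](_ : _ = (n%:R + 1) * (s * s ^+ n * (modulus h * modulus h))); last by ring.
  by rewrite !mulr_ge0 ?addr_ge0 ?exprn_ge0// ltW.
rewrite (le_trans (ler_wpM2l _ (modulusD _ _))) ?sqr_ge0// mulrDr lerD//.
  apply: le_trans (_ : s * (s ^+ 2 * modulus e) <= _); last exact: ler_wpM2l (ltW s0) _ _ IH.
  rewrite modulusM mulrCA ler_wpM2r//.
  by rewrite mulr_ge0 ?sqr_ge0 ?modulus_ge0.
rewrite modulusM [modulus (n%:R * _)]modulusM !modulusX modulus_nat mulrA.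
by rewrite ler_wpM2r ?exprn_ge0.
Qed.

Let half_powers n : \sum_(0 <= i < n) (2^-1 : R) ^+ i <= 2.
Proof.
suff -> : \sum_(0 <= i < n) (2^-1 : R) ^+ i = 2 - 2 * 2^-1 ^+ n.
  by rewrite gerBl mulr_ge0// exprn_ge0.
elim: n => [|n IH]; first by rewrite big_geq// expr0 mulr1 subrr.
by rewrite big_nat_recr//= IH exprS; field.
Qed.

Let dseries_cvg w : modulus w <= s ->
  exists l : R[i], series (fun n => b n * w ^+ n) @ \oo --> l.
Proof.
move=> ws; have [B B0 HB] := coef_bound.
have bw n : modulus (b n * w ^+ n) <= B / r * 2^-1 ^+ n.
  rewrite modulusM modulusX /b modulusM modulus_nat.
  apply: le_trans (_ : n.+1%:R * modulus (a n.+1) * s ^+ n <= _).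
    rewrite ler_wpM2l ?mulr_ge0 ?modulus_ge0//.
    by rewrite lerXn2r// nnegrE ?modulus_ge0// ltW.
  have -> : n.+1%:R * modulus (a n.+1) * s ^+ n =
      (modulus (a n.+1) * r ^+ n.+1) / r * (n.+1%:R / 8 ^+ n).
    rewrite /s expr_div_n exprS; field.
    by rewrite expf_neq0// (gt_eqF r0).
  rewrite ler_pM ?mulr_ge0 ?invr_ge0 ?exprn_ge0 ?modulus_ge0 ?(ltW r0)//.
    by rewrite ler_pM2r ?invr_gt0//.
  rewrite ler_pdivrMr ?exprn_gt0// -exprMn (_ : 2^-1 * 8 = 4); last by field.
  apply: (@le_trans _ _ (2 ^+ n)); first by rewrite -natrX ler_nat ltn_expl.
  by rewrite lerXn2r ?nnegrE// ler_nat.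
have gc : cvgn (series (fun n => B / r * 2^-1 ^+ n : R)).
  by apply: is_cvg_geometric_series; rewrite ger0_norm// invf_lt1// ltr1n.
have cpt (p : R[i] -> R) : (forall z, `|p z| <= modulus z) ->
    cvgn (series (fun n => p (b n * w ^+ n))).
  move=> pm; apply: normed_cvg.
  by apply: series_le_cvg gc => n //=; rewrite (le_trans _ (bw n))//
    ?(le_trans (normr_ge0 _) (pm _)).
have := cpt _ (@le_Re_modulus R); have := cpt _ (@le_Im_modulus R).
move=> /cvg_ex[y /= Hy] /cvg_ex[x /= Hx]; exists (x +i* y).
apply: cvg_ReIm.
  rewrite (_ : (fun n => _) = series (fun n => Re (b n * w ^+ n)))//.
  apply/funext => n; rewrite /series/=.
  by apply: (big_morph _ (@ReD R)).
rewrite (_ : (fun n => _) = series (fun n => Im (b n * w ^+ n)))//.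
apply/funext => n; rewrite /series/=.
by apply: (big_morph _ (@ImD R)).
Qed.

(** Each partial sum is its linear approximation up to an error K |h|^2 with K
    independent of the truncation; this estimate survives in the limit. It holds
    at every point near z0, hence the derivative is again a power series. *)
Lemma power_series_deriv : exists2 g : R[i] -> R[i],
  (forall z, modulus (z - z0) < s ->
    series (fun n => b n * (z - z0) ^+ n) @ \oo --> g z) &
  (forall z, modulus (z - z0) < s -> has_cderiv f z (g z)).
Proof.
have /choice[g Hg] : forall z, exists l : R[i], modulus (z - z0) < s ->
    series (fun n => b n * (z - z0) ^+ n) @ \oo --> l.
  move=> z; case: (ltP (modulus (z - z0)) s) => [/ltW/dseries_cvg[l Hl]|_].
    by exists l.
  by exists 0.
exists g => // z zs.
have [B B0 HB] := coef_bound.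
pose K := B / s ^+ 2 * 2.
have K0 : 0 < K by rewrite mulr_gt0// divr_gt0// exprn_gt0.
have sr : s < rho by rewrite /s /r; move: rho0; lra.
have main h : modulus (z - z0 + h) < s ->
    modulus (f (z + h) - f z - h * g z) <= K * modulus h ^+ 2.
  move=> zhs; set w := z - z0 in zs zhs.
  have zhE : z + h - z0 = w + h by rewrite /w addrAC.
  have c1 : (fun n => \sum_(0 <= i < n.+1) a i * (w + h) ^+ i) @ \oo --> f (z + h).
    have := @af (z + h); rewrite zhE => /(_ (lt_trans zhs sr)).
    by rewrite -(cvg_shiftS (series _)).
  have c2 : (fun n => \sum_(0 <= i < n.+1) a i * w ^+ i) @ \oo --> f z.
    have := @af z => /(_ (lt_trans zs sr)).
    by rewrite -(cvg_shiftS (series _)).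
  have c3 : (fun n => h * \sum_(0 <= i < n) b i * w ^+ i) @ \oo --> h * g z.
    by apply: cvgMr; exact: Hg.
  apply: (modulus_cvg_le (cvgB (cvgB c1 c2) c3)) => n /=.
  rewrite ?fctE /=.
  have -> : h * \sum_(0 <= i < n) b i * w ^+ i =
      \sum_(0 <= i < n.+1) a i * (i%:R * w ^+ i.-1 * h).
    rewrite big_nat_recl//= !mul0r mulr0 add0r mulr_sumr.
    by apply: eq_bigr => i _; rewrite /b; ring.
  rewrite -!sumrB.
  apply: le_trans (modulus_sum _ _) _.
  apply: le_trans (_ : \sum_(0 <= i < n.+1) B / s ^+ 2 * modulus h ^+ 2 * 2^-1 ^+ i <= _).
    apply: ler_sum => i _.
    rewrite -!mulrBr modulusM.
    have := taylor_remainder i (ltW zs) (ltW zhs).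
    set E := modulus (_ - _ - _) => HE.
    have E0 : 0 <= E by exact: modulus_ge0.
    have s20 : 0 < s ^+ 2 by rewrite exprn_gt0.
    rewrite -(ler_pM2l s20) mulrCA.
    apply: le_trans (ler_wpM2l (modulus_ge0 _) HE) _.
    have -> : modulus (a i) * (i%:R ^+ 2 * s ^+ i * modulus h ^+ 2) =
      (modulus (a i) * r ^+ i) * (i%:R ^+ 2 / 8 ^+ i) * modulus h ^+ 2.
      by rewrite /s expr_div_n; ring.
    rewrite [leRHS](_ : _ = B * 2^-1 ^+ i * modulus h ^+ 2); last first.
      by field; rewrite (gt_eqF s0).
    rewrite ler_wpM2r ?sqr_ge0// ler_pM//.
      by rewrite mulr_ge0 ?modulus_ge0 ?exprn_ge0// ltW.
    rewrite ler_pdivrMr ?exprn_gt0// -exprMn (_ : 2^-1 * 8 = 2 ^+ 2); last by field.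
    rewrite -exprM mulnC exprM lerXn2r ?nnegrE ?exprn_ge0//.
    by rewrite -natrX ler_nat ltnW// ltn_expl.
  rewrite -mulr_sumr /K mulrAC ler_wpM2r ?sqr_ge0//.
  by rewrite ler_wpM2l ?half_powers// divr_ge0 ?sqr_ge0 ?(ltW B0).
move=> e e0; exists (Num.min (s - modulus (z - z0)) (e / K)).
  by rewrite lt_min subr_gt0 zs divr_gt0.
move=> h; rewrite lt_min ltrBrDl => /andP[h1]; rewrite ltr_pdivlMr// => h2.
have zh : modulus (z - z0 + h) < s by apply: le_lt_trans h1; exact: modulusD.
apply: le_trans (main h zh) _.
by rewrite expr2 mulrA ler_wpM2r ?modulus_ge0// mulrC ltW.
Qed.

End power_series.

Section analytic.
Variable R : realType.
Implicit Types (f : R[i] -> R[i]) (z w h d : R[i]).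

Lemma analytic_deriv f : analytic_on_disk f ->
  analytic_on_disk (derive1 f) /\
  forall z, disk z -> has_cderiv f z (derive1 f z).
Proof.
move=> fa; split=> z dz; have [rho rho0 [a af]] := fa _ dz;
  have [g gs gf] := power_series_deriv rho0 af.
  exists (rho / 2 / 8); first by rewrite !divr_gt0.
  exists (fun n => n.+1%:R * a n.+1) => w wz.
  by rewrite (has_cderiv_derive1 (gf _ wz)); exact: gs.
have zz : modulus (z - z) < rho / 2 / 8 by rewrite subrr modulus0 !divr_gt0.
by rewrite (has_cderiv_derive1 (gf _ zz)); exact: gf.
Qed.

Lemma analytic_derive1 f : analytic_on_disk f -> analytic_on_disk (derive1 f).
Proof. by move=> /analytic_deriv[]. Qed.

Lemma analytic_cderiv f z : analytic_on_disk f -> modulus z < 1 ->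
  has_cderiv f z (derive1 f z).
Proof. by move=> /analytic_deriv[_ H] /diskP; exact: H. Qed.

End analytic.

(** * Derivatives along plane curves *)

(** By components, the form in which curves enter real integrals. *)
Definition has_curve_deriv (R : realType) (c : R -> R[i]) (t : R) (v : R[i]) :=
  is_derive t (1:R) (fun x => Re (c x)) (Re v) /\
  is_derive t (1:R) (fun x => Im (c x)) (Im v).

Section curve_derivative.
Variable R : realType.
Implicit Types (c : R -> R[i]) (t x : R) (v w z u : R[i]).

(** The form in which curves compose with complex differentiable functions. *)
Lemma curve_epsP c t v : has_curve_deriv c t v <->
  forall e : R, 0 < e -> exists2 del : R, 0 < del &
    forall h : R, `|h| < del ->
      modulus (c (t + h) - c t - h%:C * v) <= e * `|h|.
Proof.
have Rec h : Re (c (t + h) - c t - h%:C * v) =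
    Re (c (t + h)) - Re (c t) - h * Re v.
  by rewrite !(ReD, ReN) ReM/= mul0r subr0.
have Imc h : Im (c (t + h) - c t - h%:C * v) =
    Im (c (t + h)) - Im (c t) - h * Im v.
  by rewrite !(ImD, ImN) ImM/= mul0r addr0.
split=> [[/is_derive_epsP dr /is_derive_epsP di] e e0|H]; last first.
  split; apply/is_derive_epsP => e /H[del del0 Hdel]; exists del => // h hd.
    by rewrite -Rec (le_trans (le_Re_modulus _))// Hdel.
  by rewrite -Imc (le_trans (le_Im_modulus _))// Hdel.
have e20 : 0 < e / 2 by rewrite divr_gt0.
have [d1 d10 H1] := dr _ e20; have [d2 d20 H2] := di _ e20.
exists (Num.min d1 d2); first by rewrite lt_min d10.
move=> h; rewrite lt_min => /andP[h1 h2].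
rewrite (le_trans (modulus_ReIm _))// Rec Imc [e]splitr [leRHS]mulrDl lerD//.
  exact: H1.
exact: H2.
Qed.

Lemma curve_continuous c t v : has_curve_deriv c t v ->
  forall e : R, 0 < e -> exists2 del : R, 0 < del &
    forall h : R, `|h| < del -> modulus (c (t + h) - c t) < e.
Proof.
move=> /curve_epsP/(_ _ ltr01)[del del0 H] e e0.
have C0 : 0 < 1 + modulus v by rewrite ltr_pwDl// modulus_ge0.
exists (Num.min del (e / (1 + modulus v))).
  by rewrite lt_min del0 divr_gt0.
move=> h; rewrite lt_min ltr_pdivlMr// => /andP[/H h1]; apply: le_lt_trans.
rewrite -[X in modulus X <= _](subrK (h%:C * v)).
rewrite (le_trans (modulusD _ _))// mulrDr mulr1.
apply: lerD; first by rewrite (le_trans h1)// mul1r.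
by rewrite modulusM modulusR.
Qed.

Lemma curve_comp (f : R[i] -> R[i]) c t v d : has_curve_deriv c t v ->
  has_cderiv f (c t) d -> has_curve_deriv (f \o c) t (v * d).
Proof.
move=> cv fd; apply/curve_epsP => e e0.
have e20 : 0 < e / 2 by rewrite divr_gt0.
pose K := 1 + modulus v; have K0 : 0 < K by rewrite ltr_pwDl// modulus_ge0.
pose L := 1 + modulus d; have L0 : 0 < L by rewrite ltr_pwDl// modulus_ge0.
have [d1 d10 H1] := fd (e / 2 / K) (divr_gt0 e20 K0).
have [d2 d20 H2] := curve_continuous cv d10.
have e3 : 0 < Num.min 1 (e / 2 / L) by rewrite lt_min ltr01 divr_gt0.
have [d3 d30 H3] := (curve_epsP _ _ _).1 cv _ e3.
exists (Num.min d2 d3); first by rewrite lt_min d20.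
move=> h; rewrite lt_min => /andP[/H2 h2 /H3 h3] /=.
set k := c (t + h) - c t in h2 h3.
have kK : modulus k <= K * `|h|.
  rewrite -[k](subrK (h%:C * v)) (le_trans (modulusD _ _))// mulrDl lerD//.
    by rewrite (le_trans h3)// ler_wpM2r// ge_min lexx.
  by rewrite modulusM modulusR mulrC.
have -> : f (c (t + h)) - f (c t) - h%:C * (v * d) =
    (f (c t + k) - f (c t) - k * d) + (k - h%:C * v) * d.
  by rewrite /k addrCA subrr addr0; ring.
rewrite (le_trans (modulusD _ _))// [e]splitr [leRHS]mulrDl lerD//.
  rewrite (le_trans (H1 _ h2))//.
  have eK0 : 0 <= e / 2 / K by rewrite ltW// divr_gt0.
  apply: le_trans (ler_wpM2l eK0 kK) _.
  by rewrite mulrA divfK// gt_eqF.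
rewrite modulusM (le_trans (ler_wpM2r (modulus_ge0 _) h3))//.
apply: (@le_trans _ _ (e / 2 / L * `|h| * L)).
  apply: ler_pM; rewrite ?mulr_ge0 ?modulus_ge0 ?(ltW e3)//.
    by rewrite ler_wpM2r// ge_min lexx orbT.
  by rewrite /L lerDr.
by rewrite mulrAC divfK// gt_eqF.
Qed.

Lemma curveM c1 c2 t v1 v2 : has_curve_deriv c1 t v1 ->
  has_curve_deriv c2 t v2 ->
  has_curve_deriv (fun x => c1 x * c2 x) t (v1 * c2 t + c1 t * v2).
Proof.
move=> [r1 i1] [r2 i2]; split.
  rewrite (_ : (fun x => _) = (fun x => Re (c1 x) * Re (c2 x) - Im (c1 x) * Im (c2 x))).
    by apply: is_derive_eq; rewrite ReD !ReM /GRing.scale/=; ring.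
  by apply/funext => x; rewrite ReM.
rewrite (_ : (fun x => _) = (fun x => Re (c1 x) * Im (c2 x) + Im (c1 x) * Re (c2 x))).
  by apply: is_derive_eq; rewrite ImD !ImM /GRing.scale/=; ring.
by apply/funext => x; rewrite ImM.
Qed.

Lemma curveD c1 c2 t v1 v2 : has_curve_deriv c1 t v1 ->
  has_curve_deriv c2 t v2 ->
  has_curve_deriv (fun x => c1 x + c2 x) t (v1 + v2).
Proof.
move=> [r1 i1] [r2 i2]; split.
  rewrite (_ : (fun x => _) = (fun x => Re (c1 x) + Re (c2 x))).
    by rewrite ReD; apply: is_deriveD.
  by apply/funext => x; rewrite ReD.
rewrite (_ : (fun x => _) = (fun x => Im (c1 x) + Im (c2 x))).
  by rewrite ImD; apply: is_deriveD.
by apply/funext => x; rewrite ImD.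
Qed.

Lemma curve_conj c t v : has_curve_deriv c t v ->
  has_curve_deriv (fun x => (c x)^*) t v^*.
Proof.
have Rej z : Re z^* = Re z by case: z.
have Imj z : Im z^* = - Im z by case: z.
move=> [r1 i1]; split.
  rewrite (_ : (fun x => _) = (fun x => Re (c x))) ?Rej//.
  by apply/funext => x; rewrite Rej.
rewrite (_ : (fun x => _) = (fun x => - Im (c x))).
  by rewrite Imj; apply: is_deriveN.
by apply/funext => x; rewrite Imj.
Qed.

Lemma curve_cst z t : has_curve_deriv (fun=> z) t 0.
Proof. by split; exact: is_derive_cst. Qed.

Lemma curve_line u t : has_curve_deriv (fun x => x%:C * u) t u.
Proof.
apply/curve_epsP => e e0; exists 1 => // h _.
rewrite (_ : _ - _ = 0) ?modulus0 ?mulr_ge0 ?(ltW e0)//.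
by rewrite rmorphD/=; ring.
Qed.

Lemma curve_expi t : has_curve_deriv (@expi R) t ('i * expi t).
Proof.
split; rewrite ?ReM ?ImM /= mul0r mul1r ?sub0r ?add0r.
- exact: is_derive_cos.
- exact: is_derive_sin.
Qed.

End curve_derivative.

(** * The derivative of T_g f *)

Section real_integrals.
Variable R : realType.
Notation mu := (@lebesgue_measure R).

Lemma continuous_segment_within (f : R -> R) (a b : R) :
  (forall x, a <= x <= b -> {for x, continuous f}) ->
  {within `[a, b], continuous f}.
Proof.
move=> fc; apply: continuous_in_subspaceT => x /set_mem/=; rewrite in_itv/=.
exact: fc.
Qed.

Lemma continuous_segment_integrable (f : R -> R) (a b : R) :
  (forall x, a <= x <= b -> {for x, continuous f}) ->
  mu.-integrable `[a, b] (EFin \o f).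
Proof.
move=> fc; apply: continuous_compact_integrable; first exact: segment_compact.
exact: continuous_segment_within.
Qed.

Lemma is_derive_continuous (f : R -> R) (x d : R) :
  is_derive x 1 f d -> {for x, continuous f}.
Proof. by move=> [fx _]; apply: differentiable_continuous; exact/derivable1_diffP. Qed.

Lemma Rintegral_is_derive (F f : R -> R) (a b : R) : a < b ->
  (forall x, a <= x <= b -> is_derive x 1 F (f x)) ->
  (forall x, a <= x <= b -> {for x, continuous f}) ->
  \int[mu]_(x in `[a, b]) f x = F b - F a.
Proof.
move=> ab dF cf.
rewrite /Rintegral (@continuous_FTC2 _ f F a b ab) //.
- exact: continuous_segment_within.
- split.
  + by move=> x /[!in_itv]/= /andP[/ltW ax /ltW xb]; have [] : is_derive x 1 F (f x) by apply: dF; rewrite ax.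
  + by apply: cvg_at_right_filter; apply: (is_derive_continuous (dF a _)); rewrite lexx ltW.
  + by apply: cvg_at_left_filter; apply: (is_derive_continuous (dF b _)); rewrite lexx ltW.
- move=> x /[!in_itv]/= /andP[/ltW ax /ltW xb].
  have dFx : is_derive x 1 F (f x) by apply: dF; rewrite ax.
  by rewrite derive1E derive_val.
Qed.

(** If K is a primitive of k, then K (t s) is a primitive in t of k (t s) s, so
    that the integral equals K s - K 0. *)
Lemma is_derive_radial_integral (k : R -> R) (r : R) : 0 < r < 1 ->
  (forall x, -1 < x < 1 -> {for x, continuous k}) ->
  is_derive r (1:R) (fun s => \int[mu]_(t in `[0, 1]) (k (t * s) * s)) (k r).
Proof.
move=> /andP[r0 r1] kc.
have [a [ra a1]] : exists a, r < a /\ a < 1 by exists ((r + 1) / 2); split; lra.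
pose K x := \int[mu]_(t in `[- a, x]) k t.
have dK x : - a < x < a -> is_derive x 1 K (k x).
  move=> /andP[ax xa].
  have ka : mu.-integrable `[- a, a] (EFin \o k).
    by apply: continuous_segment_integrable => y ya; apply: kc; lra.
  have kx : {for x, continuous k} by apply: kc; lra.
  have [d e] := continuous_FTC1_closed xa ka ax kx.
  rewrite derive1E in e; exact: (DeriveDef d e).
have E (s : R) : 0 < s < a -> K s - K 0 = \int[mu]_(t in `[0, 1]) (k (t * s) * s).
  move=> /andP[s0 sa]; apply/esym.
  have ts (t : R) : 0 <= t <= 1 -> 0 <= t * s <= s.
    by move=> /andP[t0 t1]; rewrite mulr_ge0 ?(ltW s0)//= ler_piMl// ltW.
  have dl t : is_derive t (1 : R) (fun t => t * s) s.
    by apply: is_derive_eq; rewrite scaler0 add0r /GRing.scale/= mulr1.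
  have dKs (t : R) : 0 <= t <= 1 -> is_derive t (1 : R) (fun t : R => K (t * s)) (k (t * s) * s).
    move=> /ts tsb; have tsa : - a < t * s < a by lra.
    exact: (@is_derive1_comp _ K (fun t => t * s) t _ _ (dK _ tsa) (dl t)).
  have cs t : 0 <= t <= 1 -> {for t, continuous (fun t : R => k (t * s) * s)}.
    move=> /ts tsb; apply: continuousM; last exact: cvg_cst.
    have kts : {for t * s, continuous k} by apply: kc; lra.
    exact: (@continuous_comp R R R (fun t => t * s) k t
              (is_derive_continuous (dl t)) kts).
  by have := Rintegral_is_derive ltr01 dKs cs; rewrite mul1r mul0r.
have near_r : \forall s \near r, K s - K 0 = \int[mu]_(t in `[0, 1]) (k (t * s) * s).
  have : r \in `]0, a[%R by rewrite in_itv/= r0.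
  move=> /near_in_itvoo; apply: filterS => s.
  by rewrite in_itv/=; exact: E.
apply: near_eq_is_derive near_r _.
have dKr : is_derive r 1 K (k r) by apply: dK; lra.
rewrite -[k r]subr0.
exact: (@is_deriveB _ _ _ K (cst (K 0)) r 1 _ _ dKr (is_derive_cst _ _ _)).
Qed.

End real_integrals.

Section Tg_derivative.
Variable R : realType.
Implicit Types (f g : R[i] -> R[i]) (z u : R[i]).

Lemma curve_deriv_unique (c : R -> R[i]) t v w :
  has_curve_deriv c t v -> has_curve_deriv c t w -> v = w.
Proof.
move=> [[_ r1] [_ i1]] [[_ r2] [_ i2]]; apply/eqP; rewrite eq_complex.
by rewrite -r1 -r2 -i1 -i2 !eqxx.
Qed.

Lemma curve_Re_continuous (c : R -> R[i]) t v : has_curve_deriv c t v ->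
  {for t, continuous (fun x => Re (c x))}.
Proof. by case=> /is_derive_continuous. Qed.

Lemma curve_Im_continuous (c : R -> R[i]) t v : has_curve_deriv c t v ->
  {for t, continuous (fun x => Im (c x))}.
Proof. by case=> _ /is_derive_continuous. Qed.

Lemma segment_integral0 (h : R[i] -> R[i]) : segment_integral h 0 = 0.
Proof.
have E (p : R[i] -> R) : p 0 = 0 ->
    \int[@lebesgue_measure R]_(t in `[0, 1]) p (h (t%:C * 0) * 0) = 0.
  move=> p0; under eq_Rintegral do rewrite mulr0 p0.
  by rewrite /Rintegral integral0.
by rewrite /segment_integral !E.
Qed.

Lemma Tg0 g f : Tg g f 0 = 0.
Proof. exact: segment_integral0. Qed.

Lemma has_cderivM f g z d e : has_cderiv f z d -> has_cderiv g z e ->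
  has_cderiv (fun w => f w * g w) z (d * g z + f z * e).
Proof.
move=> fd ge.
have fz := (has_cderivP _ _ _).1 fd; have gz := (has_cderivP _ _ _).1 ge.
have H : is_derive z (1 : R[i]) (fun w => f w * g w) (d * g z + f z * e).
  by apply: is_derive_eq; rewrite addrC [d * _]mulrC.
exact: (has_cderivP _ _ _).2 H.
Qed.

Lemma segment_integral_radial (h : R[i] -> R[i]) u (x : R) : modulus u = 1 ->
  (forall z, modulus z < 1 -> exists d, has_cderiv h z d) ->
  0 < x < 1 ->
  has_curve_deriv (fun r => segment_integral h (r%:C * u)) x (u * h (x%:C * u)).
Proof.
move=> u1 hd x01.
have hc y : -1 < y < 1 -> exists v, has_curve_deriv (fun s => h (s%:C * u) * u) y v.
  move=> y1; have [|d Hd] := hd (y%:C * u).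
    by rewrite modulusM u1 mulr1 modulusR ltr_norml.
  exists (u * d * u + h (y%:C * u) * 0).
  by apply: curveM; [exact: curve_comp (curve_line u y) Hd|exact: curve_cst].
have Rk (r : R) z : Re (z * (r%:C * u)) = Re (z * u) * r.
  by rewrite mulrCA ReZ mulrC.
have Ik (r : R) z : Im (z * (r%:C * u)) = Im (z * u) * r.
  by rewrite mulrCA ImZ mulrC.
rewrite [u * _]mulrC; split; rewrite /segment_integral/=.
  have -> : (fun r => \int[@lebesgue_measure R]_(t in `[0, 1])
      Re (h (t%:C * (r%:C * u)) * (r%:C * u))) =
    (fun r => \int[@lebesgue_measure R]_(t in `[0, 1])
      (Re (h ((t * r)%:C * u) * u) * r)).
    apply/funext => r; apply: eq_Rintegral => t _.
    by rewrite Rk// rmorphM mulrA.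
  apply: (is_derive_radial_integral (k := fun s => Re (h (s%:C * u) * u))) => //.
  by move=> y /hc[v /curve_Re_continuous].
have -> : (fun r => \int[@lebesgue_measure R]_(t in `[0, 1])
    Im (h (t%:C * (r%:C * u)) * (r%:C * u))) =
  (fun r => \int[@lebesgue_measure R]_(t in `[0, 1])
    (Im (h ((t * r)%:C * u) * u) * r)).
  apply/funext => r; apply: eq_Rintegral => t _.
  by rewrite Ik// rmorphM mulrA.
apply: (is_derive_radial_integral (k := fun s => Im (h (s%:C * u) * u))) => //.
by move=> y /hc[v /curve_Im_continuous].
Qed.

(** T_g f being analytic, its complex derivative is determined along the radius
    through z, where it is the derivative of an integral. At the origin, which
    the radial argument misses, both sides are continuous. *)
Lemma derive1_Tg g f z : analytic_on_disk g -> analytic_on_disk f ->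
  analytic_on_disk (Tg g f) -> modulus z < 1 ->
  derive1 (Tg g f) z = f z * derive1 g z.
Proof.
move=> ga fa Fa; pose h w := f w * derive1 g w.
have hd w : modulus w < 1 -> exists d, has_cderiv h w d.
  move=> w1; eexists.
  exact: (has_cderivM (analytic_cderiv fa w1)
    (analytic_cderiv (analytic_derive1 ga) w1)).
have punctured w : w != 0 -> modulus w < 1 -> derive1 (Tg g f) w = h w.
  move=> w0 w1; have mw : 0 < modulus w.
    by rewrite lt_neqAle modulus_ge0 eq_sym modulus_eq0 w0.
  have m0 : (modulus w)%:C != 0 :> R[i] by rewrite eq_complex/= gt_eqF.
  pose u := w / (modulus w)%:C.
  have wE : w = (modulus w)%:C * u by rewrite /u mulrC divfK.
  have u1 : modulus u = 1.
    by rewrite /u modulusM modulusV modulusR ger0_norm ?modulus_ge0// divff// gt_eqF.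
  have u0 : u != 0 by rewrite -modulus_eq0 u1 oner_eq0.
  have c1 := segment_integral_radial u1 hd (introT andP (conj mw w1)).
  have c2 := curve_comp (curve_line u (modulus w))
    (analytic_cderiv Fa (_ : modulus ((modulus w)%:C * u) < 1)).
  rewrite -wE in c1 c2; apply: (mulfI u0).
  exact: curve_deriv_unique (c2 w1) c1.
have [->|z0] := eqVneq z 0; last exact: punctured.
move=> _; have o1 : @modulus R 0 < 1 by rewrite modulus0.
have [d /has_cderiv_continuous hc] := hd 0 o1.
have := has_cderiv_continuous (analytic_cderiv (analytic_derive1 Fa) o1).
move=> Fc; apply/eqP; rewrite -subr_eq0 -modulus_eq0 eq_le modulus_ge0 andbT.
apply/ler_addgt0Pr => e e0; rewrite add0r.
have e20 : 0 < e / 2 by rewrite divr_gt0.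
have [d1 d10 H1] := hc _ e20; have [d2 d20 H2] := Fc _ e20.
pose y := Num.min (2^-1) (Num.min d1 d2) / 2.
have y0 : 0 < y by rewrite divr_gt0// !lt_min invr_gt0 ltr0n d10 d20.
have : y < Num.min (2^-1) (Num.min d1 d2) by rewrite /y; move: y0; rewrite /y; lra.
rewrite !lt_min => /and3P[y1 yd1 yd2].
have my : @modulus R y%:C = y by rewrite modulusR ger0_norm// ltW.
have yn0 : y%:C != 0 :> R[i] by rewrite eq_complex/= gt_eqF.
have := H1 y%:C; have := H2 y%:C; rewrite subr0 my => /(_ yd2) + /(_ yd1).
rewrite punctured ?my//; last by lra.
rewrite modulusB.
rewrite -/(h 0).
move: (derive1 (Tg g f) 0) (h y%:C) (h 0) => A B C0 h2 h1.
rewrite -(subrKA B) (le_trans (modulusD _ _))// [e]splitr.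
exact: lerD (ltW h2) (ltW h1).
Qed.

End Tg_derivative.

(** * Test polynomials *)

Section polynomials.
Variable R : realType.
Implicit Types (p q : {poly R[i]}) (z u : R[i]).

(** The Taylor expansion of a polynomial at any point is a finite sum. *)
Lemma analytic_poly p : analytic_on_disk (horner p).
Proof.
move=> z0 _; exists 1 => //; exists (fun i => p^`N(i).[z0]) => z _.
apply/cvg_complexP => e e0; exists (size p) => n pn.
suff -> : series (fun n => p^`N(n).[z0] * (z - z0) ^+ n) n = p.[z].
  by rewrite subrr modulus0.
have -> : p.[z] = p.[z0 + (z - z0)] by rewrite addrC subrK.
rewrite nderiv_taylor; last exact: mulrC.
rewrite -(big_mkord xpredT (fun i => p^`N(i).[z0] * (z - z0) ^+ i)) /series/=.
have tail0 : \sum_(size p <= i < n) p^`N(i).[z0] * (z - z0) ^+ i = 0.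
  rewrite big_nat_cond big1// => i /andP[/andP[pi _] _].
  by rewrite (_ : p^`N(i) = 0) ?horner0 ?mul0r// nderivn_poly0.
by rewrite (big_cat_nat (n := size p))//= tail0 addr0.
Qed.

Lemma derive1_poly p z : derive1 (horner p) z = p^`().[z].
Proof.
suff /has_cderiv_derive1 : has_cderiv (horner p) z p^`().[z] by [].
elim/poly_ind: p => [|p c IH].
  apply/has_cderivP; rewrite deriv0 horner0 (_ : horner 0 = cst 0).
    exact: is_derive_cst.
  by apply/funext => w; rewrite horner0.
rewrite (_ : horner _ = (fun w => p.[w] * w + c)); last first.
  by apply/funext => w; rewrite !hornerE.
apply: (has_cderivP _ _ _).2; have fz := (has_cderivP _ _ _).1 IH.
apply: is_derive_eq.
by rewrite derivMXaddC !hornerE /GRing.scale/= mulr1 [z * _]mulrC.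
Qed.

(** The partial sums of [- log (1 - u z)]. *)
Definition log_poly u N : {poly R[i]} :=
  \sum_(k < N) (u ^+ k.+1 / k.+1%:R) *: 'X^(k.+1).

Lemma horner_log_poly u N z :
  (log_poly u N).[z] = \sum_(k < N) (u * z) ^+ k.+1 / k.+1%:R.
Proof.
rewrite horner_sum; apply: eq_bigr => k _.
by rewrite hornerZ hornerXn exprMn mulrAC.
Qed.

Lemma deriv_log_poly u N z :
  (log_poly u N)^`().[z] = u * \sum_(k < N) (u * z) ^+ k.
Proof.
rewrite raddf_sum horner_sum mulr_sumr; apply: eq_bigr => k _.
rewrite /= derivZ derivXn hornerZ hornerMn hornerXn/= -[(z ^+ k) *+ k.+1]mulr_natr.
rewrite mulrA mulrAC divfK ?pnatr_eq0//.
by rewrite exprMn exprS mulrA.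
Qed.

Lemma log_poly0 u N : (log_poly u N).[0] = 0.
Proof.
by rewrite horner_log_poly big1// => k _; rewrite mulr0 expr0n/= mul0r.
Qed.

(** The derivative is u times a geometric sum in u z, dominated by
    1 / (1 - |z|) whatever the number of terms. *)
Lemma modulus_deriv_log_poly u N z : modulus u = 1 -> modulus z < 1 ->
  modulus (log_poly u N)^`().[z] * (1 - modulus z) <= 1.
Proof.
move=> u1 z1; rewrite deriv_log_poly modulusM u1 mul1r.
apply: (@le_trans _ _ ((\sum_(k < N) modulus z ^+ k) * (1 - modulus z))).
  rewrite ler_wpM2r ?subr_ge0 ?(ltW z1)//.
  rewrite (le_trans (modulus_sum _ _))// ler_sum// => k _.
  by rewrite modulusX modulusM u1 mul1r.
rewrite mulrC -opprB mulNr -subrX1 opprB gerBl.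
by rewrite exprn_ge0 ?modulus_ge0.
Qed.

End polynomials.

Section harmonic_numbers.
Variable R : realType.

Definition harmonic_sum N : R := \sum_(k < N) k.+1%:R^-1.

(** Each dyadic block 2^j < k <= 2^(j+1) contributes at least 1/2. *)
Lemma harmonic_sum_pow2 m : m%:R / 2 <= harmonic_sum (2 ^ m).
Proof.
rewrite /harmonic_sum; elim: m => [|m IH].
  by rewrite mul0r sumr_ge0.
rewrite expnS mul2n -addnn big_split_ord/= -natr1 mulrDl lerD//.
apply: (@le_trans _ _ (\sum_(k < 2 ^ m) (2 ^ m.+1)%:R^-1)).
  rewrite sumr_const card_ord -[_ *+ 2 ^ m]mulr_natr expnS natrM invfM mul1r.
  by rewrite divfK// pnatr_eq0 -lt0n expn_gt0.
apply: ler_sum => k _; rewrite lef_pV2 ?posrE ?ltr0n ?expn_gt0// ler_nat.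
by rewrite expnS mul2n -addnn -addnS leq_add2l.
Qed.

Lemma bernoulli_ineq (x : R) n : 0 <= x <= 1 -> 1 - n%:R * x <= (1 - x) ^+ n.
Proof.
move=> /andP[x0 x1]; elim: n => [|n IH]; first by rewrite mul0r subr0.
rewrite exprS; apply: le_trans (ler_wpM2l _ IH); last by rewrite subr_ge0.
rewrite -natr1 -subr_ge0 [leRHS](_ : _ = n%:R * x ^+ 2); last by ring.
by rewrite mulr_ge0// sqr_ge0.
Qed.

Lemma exists_expr_lt (x e : R) : 0 <= x < 1 -> 0 < e -> exists n : nat, x ^+ n.+1 < e.
Proof.
move=> /andP[x0 x1] e0.
have /cvgrPdist_lt/(_ _ e0)[N _ HN] : (fun n => x ^+ n) @ \oo --> (0 : R).
  by apply: cvg_expr; rewrite ger0_norm.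
exists N; have /= := HN N.+1 (leqnSn _).
by rewrite sub0r normrN ger0_norm// exprn_ge0.
Qed.

Lemma exists_expr_ge_half n : exists2 s : R, 0 < s < 1 & 2^-1 <= s ^+ n.
Proof.
have inv1 : 0 < (n.+1%:R^-1 : R) <= 1.
  by rewrite invr_gt0 ltr0Sn/= invf_le1 ?ltr0Sn// ler1n.
exists (1 - n.+1%:R^-1 / 2); first by move: inv1; set y := _^-1; lra.
have h : 0 <= (n.+1%:R^-1 / 2 : R) <= 1 by move: inv1; set y := _^-1; lra.
apply: le_trans (bernoulli_ineq n h).
have : (n%:R / n.+1%:R : R) <= 1 by rewrite ler_pdivrMr ?ltr0Sn// mul1r ler_nat.
by rewrite mulrA; move: (n%:R / n.+1%:R) => q q1; lra.
Qed.

End harmonic_numbers.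

(** * The Bloch space *)

Section bloch.
Variable R : realType.
Implicit Types (f g : R[i] -> R[i]) (z u : R[i]).

Lemma bloch_seminorm_le f (C : R) :
  (forall z, modulus z < 1 -> modulus (derive1 f z) * (1 - modulus z ^+ 2) <= C) ->
  (bloch_seminorm f <= C%:E)%E.
Proof.
move=> H; apply: ge_ereal_sup => _ [z /diskP dz <-]; rewrite lee_fin.
exact: H.
Qed.

Lemma bloch_seminorm_ge f z : modulus z < 1 ->
  ((modulus (derive1 f z) * (1 - modulus z ^+ 2))%:E <= bloch_seminorm f)%E.
Proof.
by move=> dz; apply: ereal_sup_ubound; exists z => //; apply/diskP.
Qed.

Lemma bloch_seminorm_fin f : carrier (Bloch R) f ->
  bloch_seminorm f = (fine (bloch_seminorm f))%:E.
Proof.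
move=> [_ fy]; rewrite fineK// ge0_fin_numE//.
have o1 : @modulus R 0 < 1 by rewrite modulus0.
apply: le_trans (bloch_seminorm_ge f o1); rewrite lee_fin mulr_ge0//.
  exact: modulus_ge0.
by rewrite modulus0 expr0n subr0.
Qed.

Lemma bloch_ge f z : carrier (Bloch R) f -> modulus z < 1 ->
  modulus (derive1 f z) * (1 - modulus z ^+ 2) <= fine (bloch_seminorm f).
Proof.
by move=> fB dz; rewrite -lee_fin -bloch_seminorm_fin// bloch_seminorm_ge.
Qed.

Lemma one_sub_sqr_modulus z : modulus z < 1 ->
  0 <= 1 - modulus z ^+ 2 <= 2 * (1 - modulus z).
Proof. by have := modulus_ge0 z; nra. Qed.

Lemma carrier_bloch f (C : R) : analytic_on_disk f ->
  (forall z, modulus z < 1 -> modulus (derive1 f z) * (1 - modulus z ^+ 2) <= C) ->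
  carrier (Bloch R) f /\ fine (bloch_seminorm f) <= C.
Proof.
move=> fa /bloch_seminorm_le fC.
have fB : carrier (Bloch R) f by split => //; apply: le_lt_trans fC (ltry _).
by split=> //; rewrite -lee_fin -bloch_seminorm_fin.
Qed.

(** At |z| = 1 - 1/(2n), Bernoulli's inequality keeps |z|^(n-1) above 1/2, while
    n (1 - |z|^2) >= 1/2. *)
Lemma bloch_Xn n : (0 < n)%N -> carrier (Bloch R) (horner 'X^n) /\
  4^-1 <= fnorm (Bloch R) (horner 'X^n).
Proof.
move=> n0; have dE z : modulus (derive1 (horner 'X^n) z) = n%:R * modulus z ^+ n.-1.
  rewrite derive1_poly derivXn hornerMn hornerXn -[_ *+ n]mulr_natl.
  by rewrite modulusM modulus_nat modulusX.
have [|cX _] := @carrier_bloch (horner 'X^n) n%:R (@analytic_poly _ _).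
  move=> z z1; rewrite dE -mulrA ler_piMr//.
  have := one_sub_sqr_modulus z1; have := sqr_ge0 (modulus z).
  move=> s0 /andP[s1 _]; rewrite mulr_ile1 ?exprn_ge0 ?modulus_ge0//.
    by rewrite exprn_ile1 ?modulus_ge0 ?ltW.
  by rewrite gerBl.
split => //; have -> : fnorm (Bloch R) (horner 'X^n) = fine (bloch_seminorm (horner 'X^n)).
  by rewrite /= hornerXn expr0n gtn_eqF//= modulus0 add0r.
have n0' : 0 < n%:R :> R by rewrite ltr0n.
pose y : R := n%:R^-1 / 2.
have ny : n%:R * y = 2^-1 by rewrite /y mulrA divff ?gt_eqF// mul1r.
have n1 : 1 <= n%:R :> R by rewrite ler1n.
have y0 : 0 < y by rewrite /y divr_gt0// invr_gt0.
have y1 : y <= 2^-1 by nra.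
have mz : modulus (1 - y)%:C = 1 - y by rewrite modulusR ger0_norm//; lra.
have z1 : modulus (1 - y)%:C < 1 by rewrite mz; lra.
apply: le_trans (bloch_ge cX z1); rewrite dE mz.
have yb : 0 <= y <= 1 by lra.
have h : 2^-1 <= (1 - y) ^+ n.-1.
  apply: le_trans (bernoulli_ineq _ yb).
  have : n.-1%:R * y <= n%:R * y by rewrite ler_pM2r// ler_nat leq_pred.
  by rewrite ny; lra.
have h2 : y <= 1 - (1 - y) ^+ 2 by nra.
apply: (@le_trans _ _ (n%:R * 2^-1 * y)).
  by rewrite mulrAC ny; lra.
by rewrite ler_pM ?mulr_ge0// ?ler_pM2l// ltW.
Qed.

Lemma bloch_log_poly u N : modulus u = 1 ->
  carrier (Bloch R) (horner (log_poly u N)) /\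
  fnorm (Bloch R) (horner (log_poly u N)) <= 2.
Proof.
move=> u1; have [|cL sL] := @carrier_bloch (horner (log_poly u N)) 2 (@analytic_poly _ _).
  move=> z z1; rewrite derive1_poly; have := modulus_deriv_log_poly N u1 z1.
  have := one_sub_sqr_modulus z1; have := modulus_ge0 (log_poly u N)^`().[z].
  by nra.
by split => //=; rewrite log_poly0 modulus0 add0r.
Qed.

(** Evaluated at [z], the logarithm with singularity in the direction of [z]
    is a sum of nonnegative numbers. *)
Lemma log_poly_aligned (s : R) z N : z != 0 -> 0 < s -> s <= modulus z <= 1 ->
  exists2 u, modulus u = 1 &
    s ^+ N * harmonic_sum R N <= modulus (log_poly u N).[z].
Proof.
move=> z0 s0 /andP[sz z1]; exists ((modulus z)%:C / z).
  by rewrite modulusM modulusV modulusR ger0_norm ?modulus_ge0// divff ?modulus_eq0.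
rewrite horner_log_poly divfK//.
rewrite (_ : \sum_(k < N) _ = (\sum_(k < N) modulus z ^+ k.+1 / k.+1%:R)%:C).
  rewrite modulusR ger0_norm; last first.
    by apply: sumr_ge0 => k _; rewrite divr_ge0// exprn_ge0 ?modulus_ge0.
  rewrite mulr_sumr; apply: ler_sum => k _; rewrite ler_wpM2r ?invr_ge0//.
  apply: (@le_trans _ _ (s ^+ k.+1)).
    by rewrite ler_wiXn2l ?(ltW s0) ?(le_trans sz).
  by rewrite lerXn2r// nnegrE ?modulus_ge0// ltW.
rewrite rmorph_sum; apply: eq_bigr => k _.
by rewrite rmorphM rmorphXn fmorphV rmorph_nat.
Qed.

(** A lower bound for T_g on the z^n yields points z, arbitrarily close to the
    circle, with |g'(z)| (1 - |z|^2) > e. Boundedness, applied to the logarithm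
    that is singular in the direction of z, gives |L(z)| e <= 2 |M|, although
    |L(z)| exceeds any given bound when z is close to the circle. *)
Lemma bloch_not_bounded_below g : analytic_on_disk g ->
  bounded_on (Bloch R) (Tg g) -> ~ bounded_below_on (Bloch R) (Tg g).
Proof.
move=> ga [Tc [M TM]] [c c0 below].
have dT p z : carrier (Bloch R) (horner p) -> modulus z < 1 ->
    derive1 (Tg g (horner p)) z = p.[z] * derive1 g z.
  by move=> cp z1; exact: derive1_Tg ga (@analytic_poly R p) (Tc _ cp).1 z1.
have c1 : carrier (Bloch R) (horner 1%:P).
  apply: (@carrier_bloch (horner 1%:P) 0 (@analytic_poly _ _) _).1 => z z1.
  by rewrite derive1_poly derivC horner0 modulus0 mul0r.
pose d z := modulus (derive1 g z) * (1 - modulus z ^+ 2).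
have d0 z : modulus z < 1 -> 0 <= d z.
  by move=> /one_sub_sqr_modulus/andP[h _]; rewrite mulr_ge0 ?modulus_ge0.
pose B := fine (bloch_seminorm (Tg g (horner 1%:P))).
have dB z : modulus z < 1 -> d z <= B.
  move=> z1; have := bloch_ge (Tc _ c1) z1.
  by rewrite dT// hornerC mul1r.
(* The norm of z^n is at least 1/4; half of it makes the inequality below strict. *)
pose e := c / 8; have e0 : 0 < e by rewrite divr_gt0.
have far n : (0 < n)%N -> exists2 z, modulus z < 1 & e < modulus z ^+ n * d z.
  move=> n0; apply: contrapT => H.
  have [cX nX] := bloch_Xn n0.
  have He z : modulus z < 1 ->
      modulus (derive1 (Tg g (horner 'X^n)) z) * (1 - modulus z ^+ 2) <= e.
    move=> z1; rewrite dT// modulusM hornerXn modulusX -mulrA leNgt.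
    by apply/negP => h; apply: H; exists z.
  have [_] := carrier_bloch (Tc _ cX).1 He.
  have := below _ cX; rewrite [X in _ <= X -> _]/= Tg0 modulus0 add0r => h1 h2.
  have := le_trans h1 h2; apply/negP; rewrite -ltNge /e.
  apply: lt_le_trans (ler_wpM2l (ltW c0) nX).
  by rewrite ltr_pM2l// ltf_pV2 ?posrE// ltr_nat.
have outer s : 0 < s < 1 -> exists z, [/\ modulus z < 1, s <= modulus z & e < d z].
  move=> /andP[s0 s1].
  have B1 : 0 < 1 + `|B| by rewrite ltr_pwDl.
  have [|n hn] := @exists_expr_lt R s (e / (1 + `|B|)) _ (divr_gt0 e0 B1).
    by rewrite ltW.
  have [z z1 hz] := far n.+1 isT.
  have zn1 : modulus z ^+ n.+1 <= 1 by rewrite exprn_ile1 ?modulus_ge0 ?ltW.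
  exists z; split => //; last first.
    by apply: lt_le_trans hz _; rewrite ler_piMl ?d0.
  rewrite leNgt; apply/negP => zs.
  have zsn : modulus z ^+ n.+1 <= s ^+ n.+1.
    by rewrite lerXn2r// ?nnegrE ?modulus_ge0 ?ltW.
  rewrite ltr_pdivlMr// in hn.
  have := lt_trans hz (le_lt_trans _ hn); rewrite ltxx => /(_ _)/notF; apply.
  rewrite ler_pM ?exprn_ge0 ?modulus_ge0 ?d0//.
  by rewrite (le_trans (dB _ z1))// (le_trans (ler_norm B))// lerDr.
pose Q := `|M| * 2 / e.
have [m hm] : exists m : nat, 4 * Q < m%:R.
  exists (Num.bound (4 * Q)); apply: archi_boundP.
  by rewrite mulr_ge0// divr_ge0 ?mulr_ge0// ltW.
have [s s01 hs] := exists_expr_ge_half R (2 ^ m).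
have [z [z1 sz ez]] := outer s s01.
have /andP[s0 _] := s01.
have z0 : z != 0 by rewrite -modulus_eq0 gt_eqF// (lt_le_trans s0).
have [|u u1 hu] := log_poly_aligned (2 ^ m) z0 s0; first by rewrite sz ltW.
have [cL nL] := bloch_log_poly (2 ^ m) u1.
have := bloch_ge (Tc _ cL) z1; rewrite dT// modulusM -mulrA -/(d z).
have := TM _ cL; rewrite [X in X <= _ -> _]/= Tg0 modulus0 add0r => h1 h2.
have {h1 h2} h3 := le_trans h2 h1.
have fL0 : 0 <= fnorm (Bloch R) (horner (log_poly u (2 ^ m))).
  apply: addr_ge0; first exact: modulus_ge0.
  have o1 : @modulus R 0 < 1 by rewrite modulus0.
  apply: le_trans (bloch_ge cL o1).
  by rewrite modulus0 expr0n subr0 mulr1 modulus_ge0.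
have {h3} : modulus (log_poly u (2 ^ m)).[z] * e <= `|M| * 2.
  apply: le_trans (_ : modulus (log_poly u (2 ^ m)).[z] * d z <= _).
    by rewrite ler_wpM2l ?modulus_ge0 ?ltW.
  apply: le_trans h3 _; apply: (@le_trans _ _ (`|M| * fnorm (Bloch R) (horner (log_poly u (2 ^ m))))).
    by rewrite ler_wpM2r// ler_norm.
  by rewrite ler_wpM2l.
rewrite -ler_pdivlMr// -/Q => h4.
have := harmonic_sum_pow2 R m; move: hs hu h4 hm.
set H := harmonic_sum _ _; set a := modulus _; set b := s ^+ _ => h1 h2 h3 h4 h5.
have : 2^-1 * H <= b * H by rewrite ler_wpM2r// (le_trans _ h5)// divr_ge0.
by lra.
Qed.

End bloch.

(** * Integrals over circles *)

Section circle_means.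
Variable R : realType.
Implicit Types (f F G : R[i] -> R[i]) (z u : R[i]).
Notation mu := (@lebesgue_measure R).
Notation tau := (2 * pi : R).

(** Compactness of a square containing the disk of radius s: continuity bounds f
    near a point of the unit disk, and near any other point there is no z with
    |z| <= s. *)
Lemma cderiv_bounded f (s : R) : s < 1 ->
  (forall z, modulus z < 1 -> exists d, has_cderiv f z d) ->
  exists B : R, forall z, modulus z <= s -> modulus (f z) <= B.
Proof.
move=> s1 fd.
pose K : set (R * R) := `[- s, s]%classic `*` `[- s, s]%classic.
have cK : compact K by apply: compact_setX; exact: segment_compact.
pose P (M : R) (p : R * R) :=
  modulus (p.1 +i* p.2) <= s -> modulus (f (p.1 +i* p.2)) <= M.
have [M [_ HM]] : \forall M \near +oo, K `<=` P M.
  apply: (proj1 (compact_near_coveringP K) cK) => -[a b] _.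
  have [del [M0 [del0 Hdel]]] : exists del M0 : R, 0 < del /\
      forall w, modulus (w - (a +i* b)) < del -> modulus w <= s -> modulus (f w) <= M0.
    case: (ltP (modulus (a +i* b)) 1) => [ab1|ab1].
      have [d /has_cderiv_continuous/(_ _ ltr01)[del del0 H]] := fd _ ab1.
      exists del, (modulus (f (a +i* b)) + 1); split => // w /H h _.
      have := modulus_lowerB (f w) (f (a +i* b)); lra.
    exists (1 - s), 0; split; first lra.
    move=> w; rewrite modulusB; have := modulus_lowerB (a +i* b) w; lra.
  have d2 : 0 < del / 2 by rewrite divr_gt0.
  exists (ball (a, b) (del / 2), [set M | M0 < M]) => /=.
    split; first exact: nbhsx_ballx.
    by exists M0; split => //; exact: num_real.
  move=> [[x y] M] /= [[/= xa yb] M0M] ws; apply: le_trans (ltW M0M).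
  apply: Hdel ws; apply: le_lt_trans (modulus_ReIm _) _.
  rewrite [del]splitr; apply: ltrD.
    by move: xa; rewrite /ball/= distrC.
  by move: yb; rewrite /ball/= distrC.
have M1 : M < M + 1 by rewrite ltrDl.
exists (M + 1) => -[a b] zs; apply: (HM _ M1 (a, b) _ zs).
have := le_Re_modulus (a +i* b); have := le_Im_modulus (a +i* b).
by rewrite /K/= !in_itv/= -!ler_norml => h1 h2; split; apply: le_trans zs.
Qed.

Lemma circle_integrable (h : R -> R) : (forall t, {for t, continuous h}) ->
  mu.-integrable `[0, tau] (EFin \o h).
Proof. by move=> hc; apply: continuous_segment_integrable => t _; exact: hc. Qed.

Lemma is_derive_circle_integral (h dh : R -> R -> R) (x u v : R) : u < x < v ->
  (forall y t, u < y < v -> is_derive y (1 : R) (h^~ t) (dh y t)) ->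
  (forall y t, u < y < v -> {for t, continuous (h y)}) ->
  (exists B : R, forall y t, u < y < v -> `|dh y t| <= B) ->
  is_derive x (1 : R) (fun y => \int[mu]_(t in `[0, tau]) h y t)
    (\int[mu]_(t in `[0, tau]) dh x t).
Proof.
move=> xuv hd hc [B HB].
have iuv y : `]u, v[%classic y <-> u < y < v by rewrite /= in_itv.
have dE y t : u < y < v -> partial1of2 h y t = dh y t.
  move=> yuv; have [_ <-] := hd y t yuv; exact: partial1of2E.
have intf y : `]u, v[%classic y -> mu.-integrable `[0, tau] (EFin \o h y).
  by move=> /iuv yuv; apply: circle_integrable => t; exact: hc.
have derf y t : `]u, v[%classic y -> `[0, tau]%classic t -> derivable (h^~ t) y 1.
  by move=> /iuv yuv _; have [] := hd y t yuv.
have B0 (t : R) : 0 <= `|B| by [].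
have intB : mu.-integrable `[0, tau] (EFin \o (fun=> `|B|)).
  by apply: circle_integrable => t; exact: cvg_cst.
have ub y t : `]u, v[%classic y -> `[0, tau]%classic t -> `|partial1of2 h y t| <= `|B|.
  by move=> /iuv yuv _; rewrite dE// (le_trans (HB y t yuv))// ler_norm.
have mI : measurable (`[0, tau]%classic : set (measurableTypeR R)) by exact: measurable_itv.
have D := derivable_under_integral mI ((iuv x).2 xuv) intf derf B0 intB ub.
have V := differentiation_under_integral mI ((iuv x).2 xuv) intf derf B0 intB ub.
rewrite derive1E in V; apply: (DeriveDef D); rewrite V.
by apply: eq_Rintegral => t _; exact: dE.
Qed.

End circle_means.

(** * The Hardy-Stein identity *)

Section hardy_stein.
Variable R : realType.
Implicit Types (f F G : R[i] -> R[i]) (z u : R[i]) (x t : R).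
Notation mu := (@lebesgue_measure R).
Notation tau := (2 * pi : R).

Lemma polar_disk x t : -1 < x < 1 -> modulus (x%:C * expi t) < 1.
Proof. by move=> x1; rewrite modulusM modulusR modulus_expi mulr1 ltr_norml. Qed.

Lemma radial_deriv f x t : analytic_on_disk f -> -1 < x < 1 ->
  has_curve_deriv (fun s => f (s%:C * expi t)) x
    (expi t * derive1 f (x%:C * expi t)).
Proof.
move=> fa x1; exact: curve_comp (curve_line _ x)
  (analytic_cderiv fa (polar_disk t x1)).
Qed.

Lemma angular_deriv f x t : analytic_on_disk f -> -1 < x < 1 ->
  has_curve_deriv (fun s => f (x%:C * expi s)) t
    ((x%:C * ('i * expi t)) * derive1 f (x%:C * expi t)).
Proof.
move=> fa x1; have c := curveM (curve_cst x%:C t) (curve_expi t).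
rewrite mul0r add0r in c.
exact: curve_comp c (analytic_cderiv fa (polar_disk t x1)).
Qed.

Definition mean_square F x : R :=
  \int[mu]_(t in `[0, tau]) (modulus (F (x%:C * expi t)) ^+ 2).

(** Half of the radial derivative of [mean_square]. *)
Definition radial_mean F x : R :=
  \int[mu]_(t in `[0, tau])
    Re ((F (x%:C * expi t))^* * (expi t * derive1 F (x%:C * expi t))).

Lemma sqr_modulusE z : modulus z ^+ 2 = Re (z^* * z).
Proof. by rewrite sqr_modulus; case: z => a b /=; ring. Qed.

Lemma Re_conj z : Re z^* = Re z. Proof. by case: z. Qed.
Lemma Im_conj z : Im z^* = - Im z. Proof. by case: z. Qed.

Lemma inner_radius x : -1 < x < 1 -> exists s : R, s < 1 /\ - s < x < s.
Proof.
move=> x1; exists ((1 + `|x|) / 2).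
have xx : `|x| < 1 by rewrite ltr_norml.
split; first lra.
by rewrite -ltr_norml; lra.
Qed.

Lemma analytic_bounded f s : s < 1 -> analytic_on_disk f ->
  exists B : R, 0 <= B /\ forall z, modulus z <= s -> modulus (f z) <= B.
Proof.
move=> s1 fa; have [|B HB] := @cderiv_bounded R f s s1.
  by move=> z z1; exists (derive1 f z); exact: analytic_cderiv fa z1.
by exists `|B|; split=> // z /HB h; rewrite (le_trans h)// ler_norm.
Qed.

Lemma sqr_modulus_continuous F x t : analytic_on_disk F -> -1 < x < 1 ->
  {for t, continuous (fun t => modulus (F (x%:C * expi t)) ^+ 2)}.
Proof.
move=> Fa x1.
rewrite (_ : (fun t => _) = (fun t => Re ((F (x%:C * expi t))^* * F (x%:C * expi t)))).
  exact: (curve_Re_continuous (curveM (curve_conj (angular_deriv t Fa x1))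
    (angular_deriv t Fa x1))).
by apply/funext => s; rewrite sqr_modulusE.
Qed.

Lemma mean_square_integrable F x : analytic_on_disk F -> -1 < x < 1 ->
  mu.-integrable `[0, tau] (EFin \o (fun t => modulus (F (x%:C * expi t)) ^+ 2)).
Proof.
by move=> Fa x1; apply: circle_integrable => t; exact: sqr_modulus_continuous.
Qed.

Lemma is_derive_mean_square F x : analytic_on_disk F -> -1 < x < 1 ->
  is_derive x (1 : R) (mean_square F) (2 * radial_mean F x).
Proof.
move=> Fa x1; have [s [s1 xs]] := inner_radius x1.
have F1a := analytic_derive1 Fa.
have [B0 [B0p HB0]] := analytic_bounded s1 Fa.
have [B1 [B1p HB1]] := analytic_bounded s1 F1a.
have ys y t : - s < y < s -> -1 < y < 1 /\ modulus (y%:C * expi t) <= s.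
  move=> sy; split; first by lra.
  by rewrite modulusM modulusR modulus_expi mulr1 ler_norml; lra.
pose h y t := modulus (F (y%:C * expi t)) ^+ 2.
pose dh y t := 2 * Re ((F (y%:C * expi t))^* * (expi t * derive1 F (y%:C * expi t))).
have hd y t : - s < y < s -> is_derive y (1 : R) (h^~ t) (dh y t).
  move=> /ys-/(_ t)[y1 _].
  rewrite /h (_ : (fun y => _) = (fun y => Re ((F (y%:C * expi t))^* * F (y%:C * expi t)))); last first.
    by apply/funext => w; rewrite sqr_modulusE.
  have [H _] := curveM (curve_conj (radial_deriv t Fa y1)) (radial_deriv t Fa y1).
  apply: (@is_derive_eq _ _ _ _ _ _ _ _ H).
  rewrite /dh; move: (F _) (expi t * _) => a b.
  by rewrite ReD !ReM !Re_conj !Im_conj; ring.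
have hc y t : - s < y < s -> {for t, continuous (h y)}.
  move=> /ys-/(_ t)[y1 _].
  exact: sqr_modulus_continuous.
have hb : exists B : R, forall y t, - s < y < s -> `|dh y t| <= B.
  exists (2 * (B0 * B1)) => y t /ys-/(_ t)[y1 m1].
  rewrite /dh normrM ger0_norm// ler_wpM2l//.
  apply: le_trans (le_Re_modulus _) _; rewrite !modulusM modulus_conj modulus_expi mul1r.
  by apply: ler_pM; rewrite ?modulus_ge0 ?HB0 ?HB1.
have H := is_derive_circle_integral xs hd hc hb.
apply: (@is_derive_eq _ _ _ _ _ _ _ _ H).
rewrite /radial_mean -RintegralZl//.
apply: circle_integrable => t.
exact: (curve_Re_continuous (curveM (curve_conj (angular_deriv t Fa x1))
  (curveM (curve_expi t) (angular_deriv t F1a x1)))).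
Qed.

(** The Hardy-Stein identity, in first-order form: with [z = x e^{it}], the
    radial derivative of [Re (conj F z F')] differs from [2 x |F'|^2] by the
    angular derivative of the [2 pi]-periodic function [Im (conj F e^{it} F')]. *)
Lemma is_derive_radial_mean F x : analytic_on_disk F -> -1 < x < 1 ->
  is_derive x (1 : R) (fun y => y * radial_mean F y)
    (2 * x * mean_square (derive1 F) x).
Proof.
move=> Fa x1; have [s [s1 xs]] := inner_radius x1.
have F1a := analytic_derive1 Fa; have F2a := analytic_derive1 F1a.
have [B0 [B0p HB0]] := analytic_bounded s1 Fa.
have [B1 [B1p HB1]] := analytic_bounded s1 F1a.
have [B2 [B2p HB2]] := analytic_bounded s1 F2a.
have ys y t : - s < y < s -> -1 < y < 1 /\ modulus (y%:C * expi t) <= s.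
  move=> sy; split; first by lra.
  by rewrite modulusM modulusR modulus_expi mulr1 ler_norml; lra.
pose E t := expi t; pose Z y t := y%:C * expi t.
pose F1 := derive1 F; pose F2 := derive1 F1.
pose hcx y t := (F (Z y t))^* * ((y%:C * E t) * F1 (Z y t)).
pose dhc y t := (E t * F1 (Z y t))^* * ((y%:C * E t) * F1 (Z y t)) +
  (F (Z y t))^* * (E t * F1 (Z y t) + (y%:C * E t) * (E t * F2 (Z y t))).
have hd y t : - s < y < s -> is_derive y (1 : R) (fun y => Re (hcx y t)) (Re (dhc y t)).
  move=> /ys-/(_ t)[y1 _].
  have [] // := curveM (curve_conj (radial_deriv t Fa y1))
    (curveM (curve_line (E t) y) (radial_deriv t F1a y1)).
have hc y t : - s < y < s -> {for t, continuous (fun t => Re (hcx y t))}.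
  move=> /ys-/(_ t)[y1 _].
  exact: (curve_Re_continuous (curveM (curve_conj (angular_deriv t Fa y1))
    (curveM (curveM (curve_cst y%:C t) (curve_expi t)) (angular_deriv t F1a y1)))).
have hb : exists B : R, forall y t, - s < y < s -> `|Re (dhc y t)| <= B.
  exists (B1 * B1 + B0 * (B1 + B2)) => y t /ys-/(_ t)[y1 m1].
  apply: le_trans (le_Re_modulus _) _.
  have zy1 : modulus (y%:C * E t) <= 1 by exact/ltW/polar_disk.
  have h0 := HB0 _ m1; have h1 := HB1 _ m1; have h2 := HB2 _ m1.
  apply: le_trans (modulusD _ _) _; rewrite lerD//.
    rewrite modulusM modulus_conj [modulus (E t * _)]modulusM modulus_expi mul1r.
    rewrite ler_pM ?modulus_ge0// modulusM.
    by rewrite (le_trans _ h1)// ler_piMl ?modulus_ge0.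
  rewrite modulusM modulus_conj ler_pM ?modulus_ge0//.
  apply: le_trans (modulusD _ _) _; rewrite lerD//.
    by rewrite modulusM modulus_expi mul1r.
  rewrite modulusM [modulus (E t * _)]modulusM modulus_expi mul1r.
  by rewrite (le_trans _ h2)// ler_piMl ?modulus_ge0.
have H := is_derive_circle_integral xs hd hc hb.
have cont f g y t : analytic_on_disk f -> analytic_on_disk g -> -1 < y < 1 ->
    {for t, continuous (fun t => Re ((f (Z y t))^* * (E t * g (Z y t))))}.
  move=> fa ga y1.
  exact: (curve_Re_continuous (curveM (curve_conj (angular_deriv t fa y1))
    (curveM (curve_expi t) (angular_deriv t ga y1)))).
have near_x : \forall y \near x, \int[mu]_(t in `[0, tau]) Re (hcx y t) =
    y * radial_mean F y.
  have : x \in `]-1, 1[%R by rewrite in_itv.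
  move=> /near_in_itvoo; apply: filterS => y; rewrite in_itv/= => y1.
  rewrite -RintegralZl//; last first.
    by apply: circle_integrable => t; exact: cont.
  apply: eq_Rintegral => t _; rewrite -ReZ /hcx; congr Re.
  by rewrite -!mulrA mulrCA.
apply: (near_eq_is_derive near_x); apply: (@is_derive_eq _ _ _ _ _ _ _ _ H).
pose q t := (F (Z x t))^* * (E t * F1 (Z x t)).
pose dq t := (x%:C * ('i * E t) * F1 (Z x t))^* * (E t * F1 (Z x t)) +
  (F (Z x t))^* * (('i * E t) * F1 (Z x t) + E t * (x%:C * ('i * E t) * F2 (Z x t))).
have dqd t : has_curve_deriv q t (dq t).
  exact: (curveM (curve_conj (angular_deriv t Fa x1))
    (curveM (curve_expi t) (angular_deriv t F1a x1))).
have dqc t : {for t, continuous (fun t => Im (dq t))}.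
  have i := curveM (curve_cst 'i t) (curve_expi t).
  have xi := curveM (curve_cst x%:C t) i.
  have a1 := angular_deriv t F1a x1.
  exact: (curve_Im_continuous (curveD
    (curveM (curve_conj (curveM xi a1)) (curveM (curve_expi t) a1))
    (curveM (curve_conj (angular_deriv t Fa x1))
      (curveD (curveM i a1)
         (curveM (curve_expi t) (curveM xi (angular_deriv t F2a x1))))))).
have tau0 : 0 < tau by rewrite mulr_gt0// pi_gt0.
have q0 : \int[mu]_(t in `[0, tau]) Im (dq t) = 0.
  have qe : q tau = q 0.
    rewrite /q /Z /E (_ : expi tau = expi 0)//.
    by rewrite /expi mulr_natl cos2pi sin2pi cos0 sin0.
  have := @Rintegral_is_derive R (fun t => Im (q t)) (fun t => Im (dq t)) 0 tau tau0
    (fun t _ => (dqd t).2) (fun t _ => dqc t).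
  by rewrite qe subrr.
have split_dh t : Re (dhc x t) = 2 * x * modulus (F1 (Z x t)) ^+ 2 + Im (dq t).
  have E1 : Re (E t) ^+ 2 + Im (E t) ^+ 2 = 1 by exact: cos2Dsin2.
  rewrite /dhc /dq sqr_modulus; move: (F (Z x t)) (F1 (Z x t)) (F2 (Z x t)).
  case: (E t) E1 => c d /= cd [a1 b1] [a2 b2] [a3 b3] /=.
  apply/eqP; rewrite -subr_eq0; apply/eqP.
  transitivity (2 * x * (a2 ^+ 2 + b2 ^+ 2) * (c ^+ 2 + d ^+ 2 - 1)); first by ring.
  by rewrite cd subrr mulr0.
under eq_Rintegral do rewrite split_dh.
rewrite RintegralD//.
- rewrite q0 addr0 RintegralZl//.
  exact: (@mean_square_integrable F1 x F1a x1).
- apply: circle_integrable => t; apply: continuousM; first exact: cvg_cst.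
  exact: (@sqr_modulus_continuous F1 x t F1a x1).
- by apply: circle_integrable => t; exact: dqc.
Qed.


End hardy_stein.

(** * The Hardy space *)

Section hardy.
Variable R : realType.
Implicit Types (f g F G : R[i] -> R[i]) (z u : R[i]) (x t r s : R).
Notation mu := (@lebesgue_measure R).
Notation tau := (2 * pi : R).

Lemma is_derive_le_oo (f df : R -> R) (a b : R) : a <= b ->
  (forall x, a <= x <= b -> is_derive x (1 : R) f (df x)) ->
  (forall x, a < x < b -> 0 <= df x) -> f a <= f b.
Proof.
move=> ab fd df0; move: (ab); rewrite le_eqVlt => /orP[/eqP -> //|ltab].
have fd' x : x \in `]a, b[ -> is_derive x (1 : R) f (df x).
  by rewrite in_itv/= => /andP[/ltW ax /ltW xb]; apply: fd; rewrite ax.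
have fc := continuous_segment_within (fun x xab => is_derive_continuous (fd x xab)).
have [c /[!in_itv]/= cab] := MVT ltab fd' fc.
by rewrite -subr_ge0 => ->; rewrite mulr_ge0 ?df0// subr_ge0.
Qed.

Lemma mean_square_ge0 F x : 0 <= mean_square F x.
Proof. by apply: Rintegral_ge0 => t _; exact: sqr_ge0. Qed.

(** The function y * radial_mean F y vanishes at 0, and its derivative is
    nonnegative by the Hardy-Stein identity. *)
Lemma radial_mean_ge0 F x : analytic_on_disk F -> 0 < x < 1 ->
  0 <= radial_mean F x.
Proof.
move=> Fa /andP[x0 x1]; rewrite -(pmulr_rge0 _ x0) -[leLHS](mul0r (radial_mean F 0)).
apply: (@is_derive_le_oo (fun y => y * radial_mean F y)
  (fun y => 2 * y * mean_square (derive1 F) y) 0 x (ltW x0)) => y yx.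
  by apply: is_derive_radial_mean => //; lra.
by rewrite !mulr_ge0 ?mean_square_ge0//; lra.
Qed.

Lemma mean_square_le F r s : analytic_on_disk F -> 0 <= r <= s -> s < 1 ->
  mean_square F r <= mean_square F s.
Proof.
move=> Fa /andP[r0 rs] s1.
apply: (@is_derive_le_oo (mean_square F) (fun y => 2 * radial_mean F y) r s rs) => y yx.
  by apply: is_derive_mean_square => //; lra.
by rewrite mulr_ge0 ?radial_mean_ge0//; lra.
Qed.

Section comparison.
Variables (F G : R[i] -> R[i]) (n : nat).
Hypotheses (Fa : analytic_on_disk F) (Ga : analytic_on_disk G) (F0 : F 0 = 0).
Hypothesis FG : forall z, modulus z < 1 -> derive1 F z = z ^+ n * derive1 G z.

Let mean_square_deriv x : -1 < x < 1 ->
  mean_square (derive1 F) x = x ^+ (2 * n) * mean_square (derive1 G) x.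
Proof.
move=> x1; rewrite /mean_square -RintegralZl//; last first.
  exact: (@mean_square_integrable R _ x (analytic_derive1 Ga) x1).
apply: eq_Rintegral => t _; rewrite (FG (polar_disk t x1)).
rewrite modulusM exprMn modulusX modulusM modulusR modulus_expi mulr1.
by rewrite -exprM mulnC exprM real_normK ?num_real// -exprM.
Qed.

(** The Hardy-Stein terms of F and G differ by the factor x^(2n), so that
    x^(2n) (x radial_mean G x) - x radial_mean F x, which vanishes at 0, has the
    derivative 2n x^(2n-1) (x radial_mean G x) >= 0. *)
Let radial_mean_le x : 0 < x < 1 ->
  radial_mean F x <= x ^+ (2 * n) * radial_mean G x.
Proof.
move=> /andP[x0 x1]; rewrite -(ler_pM2l x0) mulrCA -subr_ge0.
pose a y := y * radial_mean G y; pose b y := y * radial_mean F y.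
have a0 : a 0 = 0 by exact: mul0r.
have b0 : b 0 = 0 by exact: mul0r.
rewrite -[leLHS](_ : 0 ^+ (2 * n) * a 0 - b 0 = 0); last first.
  by rewrite a0 b0 mulr0 subrr.
apply: (@is_derive_le_oo (fun y => y ^+ (2 * n) * a y - b y)
  (fun y => (2 * n)%:R * y ^+ (2 * n).-1 * a y) 0 x (ltW x0)) => y yx.
  have y1 : -1 < y < 1 by lra.
  have da := is_derive_radial_mean Ga y1.
  have db := is_derive_radial_mean Fa y1.
  rewrite (mean_square_deriv y1) in db.
  have dp : is_derive y (1 : R) (fun y : R => y ^+ (2 * n)) ((2 * n)%:R * y ^+ (2 * n).-1).
    have H := @is_deriveX R R id (2 * n) y 1 1 (is_derive_id _ _).
    rewrite exprfctE in H; apply: (@is_derive_eq _ _ _ _ _ _ _ _ H).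
    exact: mulr1.
  have H := @is_deriveB _ _ _ _ _ _ _ _ _ (@is_deriveM _ _ _ _ _ _ _ _ dp da) db.
  apply: (@is_derive_eq _ _ _ _ _ _ _ _ H).
  by rewrite /a /GRing.scale/=; ring.
have y0 : 0 <= y by lra.
have rG : 0 <= radial_mean G y by apply: (radial_mean_ge0 Ga); lra.
by rewrite /a !mulr_ge0 ?exprn_ge0.
Qed.

(** The radial derivative of the mean square of F is at most x^(2n) times that of
    G: this factor is at most s^(2n) up to s, and at most 1 from s to r. *)
Lemma mean_square_comparison r s : 0 < s <= r -> r < 1 ->
  mean_square F r <=
    s ^+ (2 * n) * mean_square G s + (mean_square G r - mean_square G s).
Proof.
move=> /andP[s0 sr] r1.
have Fzero : mean_square F 0 = 0.
  rewrite /mean_square; under eq_Rintegral do rewrite mul0r F0 modulus0 expr0n/=.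
  by rewrite /Rintegral integral0.
have inner : mean_square F s <= s ^+ (2 * n) * mean_square G s.
  rewrite -subr_ge0; apply: (@le_trans _ _ (s ^+ (2 * n) * mean_square G 0 - mean_square F 0)).
    by rewrite Fzero subr0 mulr_ge0 ?mean_square_ge0 ?exprn_ge0// ltW.
  apply: (@is_derive_le_oo (fun y => s ^+ (2 * n) * mean_square G y - mean_square F y)
    (fun y => s ^+ (2 * n) * (2 * radial_mean G y) - 2 * radial_mean F y) 0 s (ltW s0)).
    move=> y ys; have y1 : -1 < y < 1 by lra.
    have dF := is_derive_mean_square Fa y1; have dG := is_derive_mean_square Ga y1.
    have H := @is_deriveB _ _ _ _ _ _ _ _ _ (@is_deriveZ _ _ _ _ (s ^+ (2 * n)) _ _ _ dG) dF.
    exact: (@is_derive_eq _ _ _ _ _ _ _ _ H).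
  move=> y ys; have y1 : 0 < y < 1 by lra.
  rewrite subr_ge0 mulrCA ler_pM2l//; apply: le_trans (radial_mean_le y1) _.
  rewrite ler_wpM2r ?radial_mean_ge0// lerXn2r ?nnegrE//; lra.
have outer : mean_square G s - mean_square F s <= mean_square G r - mean_square F r.
  apply: (@is_derive_le_oo (fun y => mean_square G y - mean_square F y)
    (fun y => 2 * radial_mean G y - 2 * radial_mean F y) s r sr).
    move=> y ys; have y1 : -1 < y < 1 by lra.
    exact: is_deriveB (is_derive_mean_square Ga y1) (is_derive_mean_square Fa y1).
  move=> y ys; have y1 : 0 < y < 1 by lra.
  rewrite subr_ge0 (ler_pM2l (ltr0Sn R 1)); apply: le_trans (radial_mean_le y1) _.
  apply: ler_piMl; first exact: radial_mean_ge0.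
  by apply: exprn_ile1; lra.
by move: inner outer; rewrite lerBlDl; lra.
Qed.

End comparison.

Lemma hardy_mean F r : analytic_on_disk F -> 0 < r < 1 ->
  (\int[mu]_(t in `[0%R, tau]) (modulus (F (r%:C * expi t)) ^+ 2)%:E =
   (mean_square F r)%:E)%E.
Proof.
move=> Fa r1; rewrite /mean_square /Rintegral fineK//.
by apply: integrable_fin_num => //; apply: mean_square_integrable => //; lra.
Qed.

Lemma hardy_norm2_le F (C : R) : analytic_on_disk F ->
  (forall r, 0 < r < 1 -> mean_square F r <= C) -> (hardy_norm2 F <= C%:E)%E.
Proof.
move=> Fa H; apply: ge_ereal_sup => _ [r r1 <-].
by rewrite hardy_mean// lee_fin H.
Qed.

Lemma hardy_norm2_ge F r : analytic_on_disk F -> 0 < r < 1 ->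
  ((mean_square F r)%:E <= hardy_norm2 F)%E.
Proof.
by move=> Fa r1; rewrite -hardy_mean//; apply: ereal_sup_ubound; exists r.
Qed.

Lemma hardy_fin F : carrier (H2 R) F ->
  hardy_norm2 F = (fine (hardy_norm2 F))%:E.
Proof.
move=> [Fa Fy]; rewrite fineK// ge0_fin_numE//.
have h : 0 < (2^-1 : R) < 1 by lra.
by apply: le_trans (hardy_norm2_ge Fa h); rewrite lee_fin mean_square_ge0.
Qed.

Lemma mean_square_Xn n r : 0 <= r -> mean_square (horner 'X^n) r = tau * r ^+ (2 * n).
Proof.
move=> r0; rewrite /mean_square.
under eq_Rintegral do
  rewrite hornerXn modulusX modulus_polar// -exprM mulnC -[_ ^+ _]mulr1.
rewrite RintegralZl//; last by apply: circle_integrable => t; exact: cvg_cst.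
rewrite mulrC; congr (_ * _).
have dId (t : R) : is_derive t (1 : R) (fun t : R => t) 1 by exact: is_derive_id.
have tau0 : 0 < tau by rewrite mulr_gt0// pi_gt0.
by rewrite (@Rintegral_is_derive R (fun t => t) (fun=> 1) 0 tau tau0
  (fun t _ => dId t) (fun t _ => cvg_cst _)) subr0.
Qed.

Lemma carrier_H2_Xn n : carrier (H2 R) (horner 'X^n).
Proof.
split; first exact: analytic_poly.
have h : (hardy_norm2 (horner 'X^n) <= tau%:E)%E.
  apply: hardy_norm2_le => [|r /andP[r0 r1]]; first exact: analytic_poly.
  rewrite (mean_square_Xn _ (ltW r0)); apply: ler_piMr.
    by rewrite mulr_ge0// pi_ge0.
  exact: exprn_ile1 (ltW r0) (ltW r1).
exact: le_lt_trans h (ltry _).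
Qed.

Lemma hardy_norm2_Xn n : 1 <= fine (hardy_norm2 (horner ('X^n : {poly R[i]}))).
Proof.
rewrite -lee_fin -hardy_fin; last exact: carrier_H2_Xn.
have [s s01 hs] := exists_expr_ge_half R (2 * n).
apply: le_trans (hardy_norm2_ge (@analytic_poly R _) s01).
rewrite lee_fin mean_square_Xn; last by lra.
have := pi_gt0 R; have := pi_ge2 R; move: hs; set y := s ^+ _.
nra.
Qed.

(** With F_n = T_g z^n, the comparison of F_n with F_0 = T_g 1 bounds the mean
    squares of F_n by s^(2n) S + (S - m_s), where m_s are those of F_0 and S their
    supremum. Taking s close to 1 first and n large next makes this smaller than
    any positive number, whereas the norms of the z^n are bounded below. *)
Lemma H2_not_bounded_below g : analytic_on_disk g ->
  bounded_on (H2 R) (Tg g) -> ~ bounded_below_on (H2 R) (Tg g).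
Proof.
move=> ga [Tc _] [c c0 below].
pose F n := Tg g (horner ('X^n : {poly R[i]})).
have Fc n : carrier (H2 R) (F n) by apply: Tc; exact: carrier_H2_Xn.
have Fa n : analytic_on_disk (F n) := (Fc n).1.
have dF n z : modulus z < 1 -> derive1 (F n) z = z ^+ n * derive1 g z.
  by move=> z1; rewrite (derive1_Tg ga (@analytic_poly R _) (Fa n) z1) hornerXn.
have FG n z : modulus z < 1 -> derive1 (F n) z = z ^+ n * derive1 (F 0%N) z.
  by move=> z1; rewrite !dF// expr0 mul1r.
have Fz n : F n 0 = 0 by exact: Tg0.
have belowF n : c * fnorm (H2 R) (horner ('X^n : {poly R[i]})) <= fnorm (H2 R) (F n).
  by apply: below; exact: carrier_H2_Xn.
clearbody F; pose S := fine (hardy_norm2 (F 0%N)).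
have mS r : 0 < r < 1 -> mean_square (F 0%N) r <= S.
  move=> r1; rewrite -lee_fin -(hardy_fin (Fc 0%N)).
  exact: (hardy_norm2_ge (Fa 0%N) r1).
have S0 : 0 <= S.
  have h : 0 < (2^-1 : R) < 1 by lra.
  exact: le_trans (mean_square_ge0 _ _) (mS _ h).
(* The squared norm of F_n will be at most 2 e < c^2. *)
pose e := c ^+ 2 / 4; have e0 : 0 < e by rewrite divr_gt0// exprn_gt0.
have [s s01 Ss] : exists2 s, 0 < s < 1 & S - e < mean_square (F 0%N) s.
  apply: contrapT => H.
  have : (hardy_norm2 (F 0%N) <= (S - e)%:E)%E.
    apply: (hardy_norm2_le (Fa 0%N)) => r r1; rewrite leNgt; apply/negP => h.
    by apply: H; exists r.
  by rewrite (hardy_fin (Fc 0%N)) lee_fin -/S; lra.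
have [s0 s1] := andP s01.
have S10 : 0 < S + 1 by lra.
have [|n hn] := @exists_expr_lt R s (e / (S + 1)) _ (divr_gt0 e0 S10).
  by rewrite ltW.
rewrite ltr_pdivlMr// in hn.
have sn : s ^+ (2 * n.+1) * S <= e.
  have s2 : s ^+ (2 * n.+1) <= s ^+ n.+1.
    by rewrite ler_wiXn2l ?(ltW s0) ?(ltW s1)// mul2n -addnn leq_addr.
  have sp : 0 <= s ^+ n.+1 by rewrite exprn_ge0// ltW.
  apply: le_trans (ltW hn).
  by apply: ler_pM => //; [rewrite exprn_ge0// ltW|lra].
have small : (hardy_norm2 (F n.+1) <= (2 * e)%:E)%E.
  have big r : s <= r -> r < 1 -> mean_square (F n.+1) r <= 2 * e.
    move=> sr r1; have srh : 0 < s <= r by rewrite s0.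
    have := mean_square_comparison (Fa n.+1) (Fa 0%N) (Fz n.+1) (FG n.+1) srh r1.
    have r01 : 0 < r < 1 by lra.
    have := mS r r01; have := mS s s01.
    have : s ^+ (2 * n.+1) * mean_square (F 0%N) s <= s ^+ (2 * n.+1) * S.
      apply: ler_wpM2l; first by rewrite exprn_ge0// ltW.
      exact: mS.
    move: (s ^+ _) sn Ss => y.
    move: (mean_square (F n.+1) r) (mean_square (F 0%N) r) (mean_square (F 0%N) s).
    by move=> *; lra.
  apply: (hardy_norm2_le (Fa n.+1)) => r /andP[r0 r1].
  case: (leP s r) => sr; first exact: big.
  apply: le_trans (big s (lexx _) s1).
  have rs : 0 <= r <= s by rewrite !ltW.
  exact: (mean_square_le (Fa n.+1) rs s1).
have := belowF n.+1; rewrite /fnorm /=.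
have := hardy_norm2_Xn n.+1; set X := fine _ => X1.
move: small; rewrite (hardy_fin (Fc n.+1)) lee_fin; set Y := fine _ => Ye.
rewrite leNgt => /negP; apply.
have sX : 1 <= Num.sqrt X by rewrite -(@sqrtr1 R) ler_wsqrtr.
apply: (@lt_le_trans _ _ c); last by rewrite ler_pMr.
rewrite -(ger0_norm (ltW c0)) -sqrtr_sqr ltr_sqrt ?exprn_gt0//.
apply: le_lt_trans Ye _; rewrite /e.
have : 0 < c ^+ 2 by rewrite exprn_gt0.
lra.
Qed.

End hardy.

(** * Integrals and measurable functions on the plane *)

Section lower_integrals.
Context d (T : measurableType d) (R : realType) (mu : {measure set T -> \bar R}).
Implicit Types (A B : set T).

(** The integral of a nonnegative function is a supremum over simple functions,
    hence monotone in the domain and in the integrand, for arbitrary ones. *)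
Lemma le_integral_subset A B (f g : T -> \bar R) : A `<=` B ->
  (forall x, A x -> 0 <= f x <= g x)%E -> (forall x, B x -> 0 <= g x)%E ->
  (\int[mu]_(x in A) f x <= \int[mu]_(x in B) g x)%E.
Proof.
move=> AB fg g0; rewrite !ge0_integralE//; last by move=> x /fg/andP[].
apply: ereal_sup_le => _ [h /= hf <-]; exists h => //= x.
apply: le_trans (hf x) _; rewrite /patch.
case: (asboolP (A x)) => Ax.
  by rewrite !mem_set//; [case/andP: (fg _ Ax)|exact: AB].
by rewrite memNset//; case: ifPn => // /set_mem /g0.
Qed.

Lemma integral_scale_ge A (f : T -> R) (k : R) : 0 < k -> (forall x, A x -> 0 <= f x) ->
  (k%:E * \int[mu]_(x in A) (f x)%:E <= \int[mu]_(x in A) (k * f x)%:E)%E.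
Proof.
move=> k0 f0; rewrite -lee_pdivlMl//.
rewrite [leLHS]ge0_integralE; last by move=> x /f0; rewrite lee_fin.
apply: ge_ereal_sup => _ [h /= hf <-]; rewrite lee_pdivlMl//.
rewrite ge0_integralE; last by move=> x /f0 fx; rewrite lee_fin mulr_ge0// ltW.
apply: ereal_sup_ubound; exists (scale_nnsfun h (ltW k0)); last first.
  by rewrite -sintegralrM.
move=> x /=; have := hf x; rewrite /patch; case: ifP => _; rewrite !lee_fin => h1.
  by rewrite ler_wpM2l// ltW.
by rewrite pmulr_rle0.
Qed.

End lower_integrals.

Section plane.
Variable R : realType.
Implicit Types (p q : R * R) (U : set (R * R)) (z w : R[i]).
Notation mR := (measurableTypeR R).
Notation plane := (mR * mR)%type.

(** Such a set is the union of the countably many open squares with rational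
    centre and half side that it contains. *)
Lemma open_plane_measurable (U : set plane) :
  (forall p, U p -> exists2 r : R, 0 < r &
     forall q, `|q.1 - p.1| < r -> `|q.2 - p.2| < r -> U q) ->
  measurable U.
Proof.
move=> oU.
pose S (a b e : rat) : set plane :=
  `](ratr a - ratr e : R), (ratr a + ratr e : R)[%classic `*`
  `](ratr b - ratr e : R), (ratr b + ratr e : R)[%classic.
have SE a b e q : S a b e q <->
    `|q.1 - ratr a| < ratr e /\ `|q.2 - ratr b| < ratr e.
  by rewrite /S /setX/= !in_itv/= !ltr_distl.
pose V (a b e : rat) : set plane := if `[< S a b e `<=` U >] then S a b e else set0.
have -> : U = \bigcup_(a : rat) \bigcup_(b : rat) \bigcup_(e : rat) V a b e.
  apply/seteqP; split => [p Up|p [a _ [b _ [e _]]]]; last first.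
    by rewrite /V; case: asboolP => // SU; exact: SU.
  have [r r0 Hr] := oU p Up.
  have [e] : exists e : rat, (ratr e : R) \in `]0, (r / 2)[ by apply: rat_in_itvoo; rewrite divr_gt0.
  rewrite in_itv/= => /andP[e0 er].
  have [a] : exists a : rat, (ratr a : R) \in `](p.1 - ratr e), (p.1 + ratr e)[.
    by apply: rat_in_itvoo; lra.
  rewrite in_itv/= -ltr_distl => pa.
  have [b] : exists b : rat, (ratr b : R) \in `](p.2 - ratr e), (p.2 + ratr e)[.
    by apply: rat_in_itvoo; lra.
  rewrite in_itv/= -ltr_distl => pb.
  exists a => //; exists b => //; exists e => //; rewrite /V.
  have SU : S a b e `<=` U.
    move=> q /SE[qa qb]; apply: Hr.
      have := ler_distD (ratr a) q.1 p.1; lra.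
    have := ler_distD (ratr b) q.2 p.2; lra.
  by rewrite asboolT//; apply/SE; rewrite distrC [`|p.2 - _|]distrC.
apply: bigcupT_measurable_rat => a; apply: bigcupT_measurable_rat => b.
apply: bigcupT_measurable_rat => e; rewrite /V; case: ifP => _ //.
by apply: measurableX; exact: measurable_itv.
Qed.

Definition plane_disk : set plane := [set p | modulus (p.1 +i* p.2) < 1].

Lemma modulus_subr_lt p q (r : R) : `|q.1 - p.1| < r / 2 -> `|q.2 - p.2| < r / 2 ->
  modulus ((q.1 +i* q.2) - (p.1 +i* p.2)) < r.
Proof.
move=> h1 h2; apply: le_lt_trans (modulus_ReIm _) _.
by rewrite [r]splitr; exact: ltrD.
Qed.

Lemma continuous_disk_measurable (F : R[i] -> R) :
  (forall z, modulus z < 1 -> forall e : R, 0 < e -> exists2 del : R, 0 < del &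
     forall w, modulus (w - z) < del -> `|F w - F z| < e) ->
  measurable_fun plane_disk (fun p : plane => F (p.1 +i* p.2)).
Proof.
move=> Fc mD; apply: (measurability _ (RGenOInfty.measurableE R)) => //.
move=> /= _ [_ [a ->] <-]; rewrite preimage_itvoy.
apply: open_plane_measurable => p [p1 /= ap].
have e0 : 0 < F (p.1 +i* p.2) - a by rewrite subr_gt0.
have [del del0 Hdel] := Fc _ p1 _ e0.
have r0 : 0 < Num.min del (1 - modulus (p.1 +i* p.2)).
  by rewrite lt_min del0 subr_gt0.
exists (Num.min del (1 - modulus (p.1 +i* p.2)) / 2); first by rewrite divr_gt0.
move=> q h1 h2; have := modulus_subr_lt h1 h2.
rewrite lt_min => /andP[/Hdel h3 h4]; split => /=.
  have := modulus_lowerB (q.1 +i* q.2) (p.1 +i* p.2).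
  by rewrite /plane_disk/=; move: h4; lra.
have := ler_norm (- (F (q.1 +i* q.2) - F (p.1 +i* p.2))).
by rewrite normrN; move: h3; lra.
Qed.

Lemma plane_disk_measurable : measurable plane_disk.
Proof.
apply: open_plane_measurable => p p1.
have r0 : 0 < 1 - modulus (p.1 +i* p.2) by rewrite subr_gt0.
exists ((1 - modulus (p.1 +i* p.2)) / 2); first by rewrite divr_gt0.
move=> q h1 h2; have := modulus_subr_lt h1 h2.
have := modulus_lowerB (q.1 +i* q.2) (p.1 +i* p.2).
by rewrite /plane_disk/=; lra.
Qed.

Lemma modulus_measurable : measurable_fun plane_disk (fun p : plane => modulus (p.1 +i* p.2)).
Proof.
apply: (continuous_disk_measurable (F := @modulus R)) => z _ e e0.
exists e => // w we; apply: le_lt_trans we.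
rewrite ler_norml; apply/andP; split; last exact: modulus_lowerB.
by rewrite lerNl opprB modulusB modulus_lowerB.
Qed.

End plane.

(** * Arcs and Carleson boxes *)

Section carleson_constants.
Variable R : realType.
Implicit Types (m : set R[i] -> \bar R) (C : R).

Lemma carleson_bound_le m C D : carleson_bound m C -> C <= D -> carleson_bound m D.
Proof.
move=> [C0 H] CD; split; first exact: lt_le_trans CD.
move=> I l Il; have [_ [_ [_ [l0 _ _]]]] := Il.
by apply: le_trans (H _ _ Il) _; rewrite lee_fin ler_pM2r.
Qed.

Let lb m : has_lbound [set C | carleson_bound m C].
Proof. by exists 0 => C [/ltW]. Qed.

Lemma carleson_constant_le m C : carleson_bound m C -> carleson_constant m <= C.
Proof. by move=> H; apply: ge_inf. Qed.

Lemma le_carleson_constant m C : is_carleson m ->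
  (forall D, carleson_bound m D -> C <= D) -> C <= carleson_constant m.
Proof. by move=> mC H; apply: lb_le_inf. Qed.

Lemma carleson_constant_ge0 m : is_carleson m -> 0 <= carleson_constant m.
Proof. by move=> mC; apply: le_carleson_constant => // D [/ltW]. Qed.

Lemma carleson_constant_lt m C : is_carleson m -> carleson_constant m < C ->
  carleson_bound m C.
Proof.
move=> mC h; have e0 : 0 < C - carleson_constant m by rewrite subr_gt0.
have [D /= HD DC] := inf_adherent e0 (conj mC (lb m)).
by apply: carleson_bound_le HD _; rewrite -/(carleson_constant m) in DC; lra.
Qed.

End carleson_constants.

Section arcs.
Variable R : realType.
Implicit Types (z w : R[i]) (I : set R[i]) (l r t : R).

Lemma polarE z : exists2 t : R, - pi <= t <= pi & z = (modulus z)%:C * expi t.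
Proof.
have [->|z0] := eqVneq z 0.
  by exists 0; [rewrite oppr_le0 pi_ge0|rewrite modulus0 mul0r].
have m0 : 0 < modulus z by rewrite lt_neqAle modulus_ge0 eq_sym modulus_eq0 z0.
have m0' : modulus z != 0 by rewrite gt_eqF.
pose c := Re z / modulus z; pose s := Im z / modulus z.
have cs : c ^+ 2 + s ^+ 2 = 1.
  by rewrite !expr_div_n -mulrDl -sqr_modulus divff// sqrf_eq0.
have c1 : -1 <= c <= 1 by rewrite -ler_norml normrM normfV (ger0_norm (ltW m0))
  ler_pdivrMr// mul1r le_Re_modulus.
have ca : cos (acos c) = c by rewrite acosK// in_itv.
have sa : sin (acos c) = `|s|.
  by rewrite sin_acos// (_ : 1 - c ^+ 2 = s ^+ 2) ?sqrtr_sqr// -cs addrAC subrr add0r.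
have zE : z = (modulus z)%:C * (c +i* s).
  apply/eqP; rewrite eq_complex ReZ ImZ /= /c /s.
  by rewrite ![modulus z * _]mulrC !divfK// !eqxx.
have a0 := acos_ge0 c1; have a1 := acos_lepi c1.
case: (leP 0 s) => s0.
  exists (acos c); first by rewrite a1 (le_trans _ a0)// oppr_le0 pi_ge0.
  by rewrite /expi ca sa ger0_norm.
exists (- acos c); first by rewrite lerN2 a1 (le_trans _ (pi_ge0 R))// oppr_le0.
by rewrite /expi cosN sinN ca sa ltr0_norm// opprK.
Qed.

Lemma full_circle_box : exists2 I, is_arc I (2 * pi : R) &
  @disk R `<=` carleson_box I (2 * pi).
Proof.
exists [set expi t | t in `[- pi, - pi + 2 * pi]].
  by exists (- pi), true, false; split=> //; rewrite mulr_gt0// pi_gt0.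
move=> z /diskP z1; have [t tpi zE] := polarE z.
exists (modulus z), t; split => //; first exact: modulus_ge0.
  by have := pi_ge2 R; have := modulus_ge0 z; lra.
exists t => //; rewrite /= in_itv/=; move: tpi; lra.
Qed.

Lemma expi_dist s t : modulus (expi s - expi t) <= 2 * `|s - t| :> R.
Proof.
have mvt (f df : R -> R) : (forall x, is_derive x (1 : R) f (df x)) ->
    (forall x, `|df x| <= 1) -> `|f s - f t| <= `|s - t|.
  move=> fd df1.
  wlog st : s t / t < s.
    move=> H; case: (ltgtP t s) => [/H//|st|->]; last by rewrite !subrr.
    by rewrite distrC [`|s - t|]distrC; apply: H.
  have fd' x : x \in `]t, s[ -> is_derive x (1 : R) f (df x) by move=> _; exact: fd.
  have fc := continuous_segment_within (fun x (_ : t <= x <= s) => is_derive_continuous (fd x)).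
  have [c _ ->] := MVT st fd' fc.
  by rewrite normrM ler_piMl.
apply: le_trans (modulus_ReIm _) _; rewrite ReD ReN ImD ImN mulr_natl mulr2n.
apply: lerD.
  apply: (mvt (@cos R) (fun x => - sin x)) => x.
  by rewrite normrN ler_norml sin_geN1 sin_le1.
apply: (mvt (@sin R) (@cos R)) => x.
by rewrite ler_norml cos_geN1 cos_le1.
Qed.

Lemma carleson_box_modulus I l z : carleson_box I l z -> 1 - l < modulus z < 1.
Proof. by move=> [r [t [r0 lr r1 _ ->]]]; rewrite modulus_polar// lr. Qed.

Lemma carleson_box_near I l : is_arc I l ->
  exists2 c, modulus c = 1 & forall z, carleson_box I l z -> modulus (z - c) <= 3 * l.
Proof.
move=> [a [b1 [b2 [l0 l1 ->]]]]; exists (expi a); first exact: modulus_expi.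
move=> _ [r [t [r0 lr r1 [s sal <-] ->]]].
have ls : `|s - a| <= l.
  move: sal; rewrite /= in_itv /=.
  by case: b1 b2 => [] [] /=; rewrite ?lteifT ?lteifF => /andP[h1 h2]; rewrite ler_norml; lra.
rewrite (_ : _ - _ = (r - 1)%:C * expi s + (expi s - expi a)); last first.
  by rewrite rmorphB/=; ring.
apply: le_trans (modulusD _ _) _; rewrite modulusM modulusR modulus_expi mulr1.
have -> : `|r - 1| = 1 - r by rewrite ler0_norm ?opprB//; lra.
by have := expi_dist s a; lra.
Qed.

End arcs.

(** * Upper Carleson bounds *)

Section carleson_upper.
Variable R : realType.
Implicit Types (f : R[i] -> R[i]) (z w u c : R[i]) (l r t : R).
Notation mR := (measurableTypeR R).
Notation plane := (mR * mR)%type.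
Notation mu2 := ((@lebesgue_measure R) \x (@lebesgue_measure R))%E.

Definition weight f (p : plane) : R :=
  modulus (derive1 f (p.1 +i* p.2)) ^+ 2 * (1 - modulus (p.1 +i* p.2) ^+ 2).

Lemma mu_derivE f A : mu_deriv f A =
  (\int[mu2]_(p in [set p : plane | (A `&` @disk R) (p.1 +i* p.2)])
    (weight f p)%:E)%E.
Proof. by []. Qed.

Lemma weight_ge0 f p : modulus (p.1 +i* p.2) < 1 -> 0 <= weight f p.
Proof.
by move=> /one_sub_sqr_modulus/andP[h _]; rewrite mulr_ge0// sqr_ge0.
Qed.

(** Closed squares serve as neighbourhoods because their area is immediate. *)
Definition square c (r : R) : set plane :=
  `[Re c - r, Re c + r]%classic `*` `[Im c - r, Im c + r]%classic.

Lemma squareP c r (p : plane) : modulus ((p.1 +i* p.2) - c) <= r -> square c r p.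
Proof.
move=> h; have := le_Re_modulus ((p.1 +i* p.2) - c).
have := le_Im_modulus ((p.1 +i* p.2) - c).
rewrite ReD ReN ImD ImN /square /setX /= !in_itv /= !ler_norml.
by move=> h1 h2; split; lra.
Qed.

Lemma square_measurable c r : measurable (square c r).
Proof. by apply: measurableX; exact: measurable_itv. Qed.

Lemma area_square c r : 0 < r -> mu2 (square c r) = ((2 * r) ^+ 2)%:E.
Proof.
move=> r0; rewrite product_measure1E; try exact: measurable_itv.
have E (x : R) : lebesgue_measure (`[x - r, x + r]%classic : set mR) = (2 * r)%:E.
  rewrite lebesgue_measure_itv/= lte_fin ifT; last by lra.
  by rewrite -EFinB; congr (_%:E); ring.
transitivity ((2 * r)%:E * (2 * r)%:E)%E; last by rewrite -EFinM expr2.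
by congr (_ * _)%E; exact: E.
Qed.

Definition step k (a : nat -> R) (Q : nat -> set plane) (p : plane) : R :=
  \sum_(j < k) a j * \1_(Q j) p.

Lemma integral_step k (a rad : nat -> R) c :
  (forall j, 0 <= a j) -> (forall j, 0 < rad j) ->
  (\int[mu2]_(p in setT) (step k a (fun j => square c (rad j)) p)%:E =
   (\sum_(j < k) a j * (2 * rad j) ^+ 2)%:E)%E.
Proof.
move=> a0 r0; rewrite /step; under eq_integral do rewrite -sumEFin.
have ind0 j (p : plane) : (0 <= (\1_(square c (rad j)) p : R)%:E)%E.
  by rewrite lee_fin.
have mind j : measurable_fun [set: plane] (fun p => (\1_(square c (rad j)) p : R)%:E).
  apply/measurable_EFinP; apply: measurable_indic; exact: square_measurable.
rewrite ge0_integral_sum//=; last 2 first.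
- move=> j; under eq_fun do rewrite EFinM.
  by apply: emeasurable_funM => //; exact: measurable_cst.
- by move=> j p _; rewrite lee_fin mulr_ge0.
rewrite -sumEFin; apply: eq_bigr => j _.
under eq_integral do rewrite EFinM.
rewrite ge0_integralZl_EFin//.
rewrite integral_indic//; last exact: square_measurable.
by rewrite setIT EFinM; congr (_ * _)%E; exact: area_square.
Qed.

(** A function whose derivative is square integrable over the disk induces a
    Carleson measure: on the box over an arc of length [l] the factor
    [1 - |z|^2] is at most [2 l]. *)
Lemma carleson_bound_of_step f k (a rad : nat -> R) c (D : R) :
  (forall j, 0 <= a j) -> (forall j, 0 < rad j) -> 0 < D ->
  (forall p : plane, modulus (p.1 +i* p.2) < 1 ->
    modulus (derive1 f (p.1 +i* p.2)) ^+ 2 <=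
    step k a (fun j => square c (rad j)) p) ->
  \sum_(j < k) a j * (2 * rad j) ^+ 2 <= D ->
  carleson_bound (mu_deriv f) (2 * D).
Proof.
move=> a0 r0 D0 fa aD; split; first by rewrite mulr_gt0.
move=> I l Il; have [_ [_ [_ [l0 _ _]]]] := Il.
have b0 j : 0 <= 2 * l * a j by rewrite !mulr_ge0// ltW.
rewrite mu_derivE.
apply: (@le_trans _ _ (\int[mu2]_(p in setT)
    (step k (fun j => 2 * l * a j) (fun j => square c (rad j)) p)%:E)%E).
  apply: le_integral_subset => // p; last first.
    by move=> _; rewrite lee_fin sumr_ge0// => j _; rewrite mulr_ge0.
  move=> [Ip /diskP p1]; rewrite !lee_fin weight_ge0//=.
  have /andP[lp _] := carleson_box_modulus Ip.
  have /andP[h1 h2] := one_sub_sqr_modulus p1.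
  have := fa p p1; rewrite /weight => h3.
  apply: le_trans (ler_wpM2r h1 h3) _.
  have s0 : 0 <= step k a (fun j => square c (rad j)) p.
    by apply: le_trans h3; exact: sqr_ge0.
  have h4 : 1 - modulus (p.1 +i* p.2) ^+ 2 <= 2 * l by lra.
  apply: le_trans (ler_wpM2l s0 h4) _.
  rewrite mulrC /step mulr_sumr le_eqVlt; apply/orP; left; apply/eqP.
  by apply: eq_bigr => j _; rewrite mulrA.
rewrite integral_step// lee_fin.
rewrite (_ : \sum_(j < k) _ = 2 * l * (\sum_(j < k) a j * (2 * rad j) ^+ 2)); last first.
  by rewrite mulr_sumr; apply: eq_bigr => j _; rewrite !mulrA.
by rewrite [leRHS]mulrAC ler_wpM2l// mulr_ge0// ltW.
Qed.

Lemma carleson_Xn n : carleson_bound (mu_deriv (horner ('X^n : {poly R[i]})))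
  (2 * (4 * n%:R ^+ 2 + 1)).
Proof.
have D0 : 0 < 4 * n%:R ^+ 2 + 1 :> R by rewrite ltr_wpDl// mulr_ge0// sqr_ge0.
apply: (@carleson_bound_of_step _ 1 (fun=> n%:R ^+ 2) (fun=> 1) 0) => //.
- move=> p p1; rewrite /step big_ord1 indicE mem_set ?mulr1; last first.
    by apply: squareP; rewrite subr0 ltW.
  rewrite derive1_poly derivXn hornerMn hornerXn -[_ *+ n]mulr_natl modulusM.
  rewrite modulus_nat modulusX exprMn ler_piMr ?sqr_ge0// -exprM.
  by rewrite exprn_ile1 ?modulus_ge0// ltW.
- by rewrite big_ord1 mulr1 -subr_ge0 (_ : _ - _ = 1) //; ring.
Qed.

(** When 2^-j < d <= 2^(1-j), the term of index j alone is at least 4 / d^2; below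
    the last scale, the last term is at least the bound 4 4^m on v. *)
Lemma dyadic_step_bound m (v d : R) : 0 <= v -> 0 <= d <= 2 -> v * d ^+ 2 <= 4 ->
  v <= 4 * 4 ^+ m ->
  v <= \sum_(j < m.+1) 4 * 4 ^+ j * (d <= 2 * 2^-1 ^+ j)%R%:R.
Proof.
move=> v0 /andP[d0 d2] vd; have T0 j : 0 <= 4 * 4 ^+ j * (d <= 2 * 2^-1 ^+ j)%R%:R :> R.
  by rewrite !mulr_ge0// exprn_ge0.
elim: m => [|m IH] vm.
  by rewrite big_ord1 !expr0 !mulr1 d2 mulr1 -[4]mulr1.
rewrite big_ord_recr/=; case: (leP d (2 * 2^-1 ^+ m.+1)) => dm.
  by rewrite mulr1 (le_trans vm)// lerDr sumr_ge0.
rewrite mulr0 addr0; apply: IH.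
have h : 0 < (2^-1 : R) ^+ m by rewrite exprn_gt0// invr_gt0.
have dh : 2^-1 ^+ m < d by move: dm; rewrite exprS mulrA divff// mul1r.
have d2h : (2^-1 ^+ m) ^+ 2 <= d ^+ 2 by rewrite lerXn2r ?nnegrE ?(ltW h) ?(ltW dh).
have hE : (2^-1 ^+ m) ^+ 2 * 4 ^+ m = 1 :> R.
  by rewrite -exprM mulnC exprM -exprMn (_ : 2^-1 ^+ 2 * 4 = 1) ?expr1n//; field.
have := ler_wpM2l v0 d2h => h1.
have h4 : 0 <= (4 : R) ^+ m by rewrite exprn_ge0.
have := ler_wpM2r h4 (le_trans h1 vd); rewrite -mulrA hE mulr1.
by [].
Qed.

(** The derivative of the logarithm with N = 2^m terms has modulus
    |1 - (u z)^N| / |1 - u z|, which is at most N and at most 2 / |z - 1/u|. Its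
    square is thus dominated by m + 1 dyadic squares around 1/u, each of which
    contributes the constant 64. The bound is linear in m, whereas the square of
    the harmonic sum with 2^m terms grows quadratically. *)
Lemma carleson_log_poly m u : modulus u = 1 ->
  carleson_bound (mu_deriv (horner (log_poly u (2 ^ m)))) (2 * (64 * m.+1%:R)).
Proof.
move=> u1; have u0 : u != 0 by rewrite -modulus_eq0 u1 oner_eq0.
apply: (@carleson_bound_of_step _ m.+1 (fun j => 4 * 4 ^+ j)
   (fun j => 2 * 2^-1 ^+ j) u^-1) => //.
- move=> p; set z := p.1 +i* p.2 => z1.
  set L := derive1 _ z.
  pose d := modulus (z - u^-1).
  have dE : modulus (1 - u * z) = d.
    rewrite /d -[RHS]mul1r -u1 -modulusM mulrBr divff// modulusB.
    by [].
  have uz : modulus (u * z) <= 1 by rewrite modulusM u1 mul1r ltW.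
  have LE : modulus L = modulus (\sum_(k < 2 ^ m) (u * z) ^+ k).
    by rewrite /L derive1_poly deriv_log_poly modulusM u1 mul1r.
  have LN : modulus L <= 2 ^+ m.
    rewrite LE (le_trans (modulus_sum _ _))//.
    apply: (@le_trans _ _ (\sum_(k < 2 ^ m) 1)); last by rewrite sumr_const card_ord -natrX.
    by apply: ler_sum => k _; rewrite modulusX exprn_ile1 ?modulus_ge0.
  have Ld : modulus L * d <= 2.
    rewrite LE -dE -modulusM mulrC -opprB mulNr -subrX1 opprB.
    apply: le_trans (modulusD _ _) _; rewrite modulus1 modulusN modulusX.
    have : modulus (u * z) ^+ (2 ^ m) <= 1 by rewrite exprn_ile1 ?modulus_ge0.
    lra.
  have d2 : 0 <= d <= 2.
    rewrite modulus_ge0/= /d (le_trans (modulusD _ _))// modulusN modulusV u1 invr1.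
    by lra.
  have L0 := modulus_ge0 L.
  apply: le_trans (@dyadic_step_bound m (modulus L ^+ 2) d _ d2 _ _) _.
  + exact: sqr_ge0.
  + rewrite -exprMn (_ : 4 = 2 ^+ 2); last by ring.
    by rewrite lerXn2r ?nnegrE ?mulr_ge0//; case/andP: d2.
  + have h : modulus L ^+ 2 <= (2 ^+ m) ^+ 2 by rewrite lerXn2r ?nnegrE ?exprn_ge0.
    apply: le_trans h _; rewrite -exprM mulnC exprM (_ : 2 ^+ 2 = 4 :> R); last by ring.
    by rewrite ler_peMl ?exprn_ge0//; lra.
  apply: ler_sum => j _; rewrite ler_wpM2l ?mulr_ge0 ?exprn_ge0//.
  case: (leP d _) => dj; last by rewrite indicE.
  by rewrite indicE mem_set//; apply: squareP.
have area j : 4 * 4 ^+ j * (2 * (2 * 2^-1 ^+ j)) ^+ 2 = 64 :> R.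
  have h : (2^-1 ^+ j) ^+ 2 * 4 ^+ j = 1 :> R.
    by rewrite -exprM mulnC exprM -exprMn (_ : 2^-1 ^+ 2 * 4 = 1) ?expr1n//; field.
  transitivity (64 * ((2^-1 ^+ j) ^+ 2 * 4 ^+ j) : R); last by rewrite h mulr1.
  by move: (2^-1 ^+ j) (4 ^+ j) => x y; ring.
rewrite (eq_bigr (fun=> 64)); last by move=> j _; exact: area.
by rewrite sumr_const card_ord mulr_natr.
Qed.

Lemma carrier_BMOA_poly (p : {poly R[i]}) (D : R) :
  carleson_bound (mu_deriv (horner p)) D ->
  carrier (BMOA R) (horner p).
Proof. by move=> H; split; [exact: analytic_poly|exists D]. Qed.

End carleson_upper.

(** * Lower Carleson bounds and vanishing tails *)

Section carleson_lower.
Variable R : realType.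
Implicit Types (f : R[i] -> R[i]) (z w u c : R[i]).
Notation mR := (measurableTypeR R).
Notation plane := (mR * mR)%type.
Notation mu2 := ((@lebesgue_measure R) \x (@lebesgue_measure R))%E.

Definition quarter_annulus (a b : R) : set plane :=
  (`]0, (2^-1 : R)[%classic `*` `]0, +oo[%classic) `&`
  [set p : plane | p.1 ^+ 2 + p.2 ^+ 2 \in `]a, b[].

Lemma quarter_annulus_measurable a b : measurable (quarter_annulus a b).
Proof.
apply: measurableI; first by apply: measurableX; exact: measurable_itv.
have mh : measurable_fun [set: plane] (fun p : plane => p.1 ^+ 2 + p.2 ^+ 2).
  apply: measurable_funD; apply: measurable_funX.
    exact: measurable_fst.
  exact: measurable_snd.
have := mh measurableT `]a, b[%classic (measurable_itv _).
by rewrite setTI.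
Qed.

(** The slice over x contains the interval between the square roots s and r of
    b - x^2 and a - x^2, whose length is (b - a) / (s + r) >= (b - a) / 2. *)
Lemma area_quarter_annulus (a b : R) : 2^-1 <= a -> a < b -> b <= 1 ->
  (((b - a) / 4)%:E <= mu2 (quarter_annulus a b))%E.
Proof.
move=> a0 ab b1.
have mE := quarter_annulus_measurable a b.
have slice (x : R) : 0 < x < 2^-1 ->
    (((b - a) / 2)%:E <= lebesgue_measure (xsection (quarter_annulus a b) x : set mR))%E.
  move=> /andP[x0 x2].
  have x20 : 0 <= x ^+ 2 <= 4^-1 by nra.
  set s := Num.sqrt (b - x ^+ 2); set r := Num.sqrt (a - x ^+ 2).
  have r0 : 0 <= r by exact: sqrtr_ge0.
  have rr : r ^+ 2 = a - x ^+ 2 by rewrite sqr_sqrtr//; lra.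
  have ss : s ^+ 2 = b - x ^+ 2 by rewrite sqr_sqrtr//; lra.
  have s0 : 0 <= s by exact: sqrtr_ge0.
  have rs : r < s by nra.
  have s1 : s <= 1 by nra.
  have sub : `]r, s[%classic `<=` (xsection (quarter_annulus a b) x : set mR).
    move=> y; rewrite /= in_itv/= => /andP[ry ys].
    apply/xsectionP; split; rewrite /= !in_itv/=.
      by split; [rewrite x0 x2|rewrite andbT; lra].
    by apply/andP; split; nra.
  apply: (@le_trans _ _ (lebesgue_measure (`]r, s[%classic : set mR))).
    rewrite lebesgue_measure_itv/= lte_fin rs -EFinB lee_fin.
    by nra.
  apply: le_measure => //; rewrite inE.
    exact: measurable_itv.
  exact: measurable_xsection.
have len : lebesgue_measure (`]0, (2^-1 : R)[%classic : set mR) = (2^-1)%:E.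
  by rewrite lebesgue_measure_itv/= lte_fin invr_gt0 ltr0n/= -EFinB subr0.
have -> : ((b - a) / 4)%:E =
    (\int[@lebesgue_measure R]_(x in (`]0%R, (2^-1 : R)%R[%classic : set mR)) ((b - a) / 2)%:E)%E.
  rewrite integral_cst; last exact: measurable_itv.
  transitivity (((b - a) / 2)%:E * (2^-1)%:E)%E.
    by rewrite -EFinM; congr (_%:E); field.
  by congr (_ * _)%E; exact/esym.
apply: le_integral_subset => // x.
rewrite /= in_itv/= => x02; rewrite lee_fin; apply/andP; split; last exact: slice.
by lra.
Qed.

(** On the ring 1 - 1/(2n) < |z|^2 < 1 - 1/(4n), whose area is of order 1/n, the
    density n^2 |z|^(2n-2) (1 - |z|^2) is at least n/8. The box over the full
    circle therefore has measure bounded below. *)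
Lemma BMOA_Xn_lower n (C : R) : (0 < n)%N ->
  carleson_bound (mu_deriv (horner ('X^n : {poly R[i]}))) C ->
  (256 * pi)^-1 <= C.
Proof.
move=> n0 [C0 /(_ _ _)HC].
have [I Iarc box] := full_circle_box R.
have := HC _ _ Iarc => HI.
have nn0 : 0 < n%:R :> R by rewrite ltr0n.
pose y : R := n%:R^-1 / 4.
have ny : n%:R * y = 4^-1 by rewrite /y mulrA divff ?gt_eqF// mul1r.
have n1 : 1 <= n%:R :> R by rewrite ler1n.
have y0 : 0 < y by rewrite /y divr_gt0// invr_gt0.
have y1 : y <= 4^-1 by nra.
pose a := 1 - 2 * y; pose b := 1 - y.
have ha : 2^-1 <= a by rewrite /a; lra.
have ab : a < b by rewrite /a /b; lra.
have b1 : b <= 1 by rewrite /b; lra.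
have E0 := area_quarter_annulus ha ab b1.
set E := quarter_annulus a b in E0.
have sq (p : plane) : modulus (p.1 +i* p.2) ^+ 2 = p.1 ^+ 2 + p.2 ^+ 2.
  by rewrite sqr_modulus.
have lowE (p : plane) : E p -> modulus (p.1 +i* p.2) < 1 /\
    n%:R / 8 <= weight (horner ('X^n : {poly R[i]})) p.
  move=> [_ /=]; rewrite in_itv/= -sq => /andP[ap pb].
  have m0 := modulus_ge0 (p.1 +i* p.2).
  have m1 : modulus (p.1 +i* p.2) < 1 by nra.
  split => //; rewrite /weight derive1_poly derivXn hornerMn hornerXn.
  rewrite -[X in modulus X]mulr_natl modulusM modulus_nat modulusX exprMn -exprM mulnC exprM.
  have yb : 0 <= 2 * y <= 1 by lra.
  have h : 2^-1 <= (modulus (p.1 +i* p.2) ^+ 2) ^+ n.-1.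
    apply: (@le_trans _ _ (a ^+ n.-1)).
      apply: le_trans (bernoulli_ineq _ yb).
      have : n.-1%:R * y <= n%:R * y by rewrite ler_pM2r// ler_nat leq_pred.
      by rewrite ny [_ * (2 * y)]mulrCA; move: (n.-1%:R * y) => v; lra.
    by rewrite lerXn2r ?nnegrE ?sqr_ge0 ?(ltW ap)//; lra.
  have h2 : y <= 1 - modulus (p.1 +i* p.2) ^+ 2 by move: pb; rewrite /b; lra.
  apply: (@le_trans _ _ (n%:R ^+ 2 * 2^-1 * y)).
    have -> : n%:R ^+ 2 * 2^-1 * y = n%:R * 2^-1 * (n%:R * y) by ring.
    by rewrite ny; lra.
  have n20 : 0 <= n%:R ^+ 2 :> R by exact: sqr_ge0.
  have n22 : 0 <= n%:R ^+ 2 * 2^-1 :> R by rewrite mulr_ge0.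
  exact: ler_pM n22 (ltW y0) (ler_wpM2l n20 h) h2.
have : ((n%:R / 8 * ((b - a) / 4))%:E <= (C * (2 * pi))%:E)%E.
  apply: le_trans HI; rewrite mu_derivE.
  apply: (@le_trans _ _ (\int[mu2]_(p in E) (cst (n%:R / 8)%:E p))%E).
    rewrite integral_cst; last exact: quarter_annulus_measurable.
    by rewrite EFinM; apply: lee_wpmul2l => //; rewrite lee_fin divr_ge0.
  apply: le_integral_subset => p.
  - by move=> /lowE[p1 _]; split; [apply: box|]; apply/diskP.
  - by move=> /lowE[_ h] /=; rewrite !lee_fin h divr_ge0.
  - by move=> [_ /diskP p1]; rewrite lee_fin weight_ge0.
rewrite lee_fin (_ : b - a = y); last by rewrite /a /b; ring.
rewrite (_ : _ * (y / 4) = n%:R * y / 32); last by field.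
rewrite ny => h; have p0 := pi_gt0 R.
have pp : 0 < 256 * pi :> R by rewrite pmulr_rgt0 ?ltr0n.
by rewrite -div1r (ler_pdivrMr _ _ pp); lra.
Qed.

End carleson_lower.

Section tail.
Variable R : realType.
Implicit Types (f : R[i] -> R[i]).
Notation mR := (measurableTypeR R).
Notation plane := (mR * mR)%type.
Notation mu2 := ((@lebesgue_measure R) \x (@lebesgue_measure R))%E.

Lemma weight_measurable f : analytic_on_disk f ->
  measurable_fun (@plane_disk R) (weight f).
Proof.
move=> fa; apply: measurable_funM.
  apply: measurable_funX.
  apply: (@continuous_disk_measurable R (fun z => modulus (derive1 f z))).
  move=> z z1 e e0.
  have [del del0 H] := has_cderiv_continuous
    (analytic_cderiv (analytic_derive1 fa) z1) e0.
  exists del => // w /H; apply: le_lt_trans.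
  rewrite ler_norml; apply/andP; split; last exact: modulus_lowerB.
  by rewrite lerNl opprB modulusB modulus_lowerB.
by apply: measurable_funB => //; apply: measurable_funX; exact: modulus_measurable.
Qed.

(** Dominated convergence: |z|^(2n) tends to 0 at every point of the disk. *)
Lemma weighted_tail_small f : analytic_on_disk f ->
  (\int[mu2]_(p in @plane_disk R) (weight f p)%:E < +oo)%E ->
  forall e : R, 0 < e -> exists n : nat,
  (\int[mu2]_(p in @plane_disk R)
     (modulus (p.1 +i* p.2) ^+ (2 * n.+1) * weight f p)%:E < e%:E)%E.
Proof.
move=> fa fin e e0; have mD := @plane_disk_measurable R.
have mw := weight_measurable fa.
pose F n (p : plane) := (modulus (p.1 +i* p.2) ^+ (2 * n.+1) * weight f p)%:E.
have mF n : measurable_fun (@plane_disk R) (F n).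
  apply/measurable_EFinP; apply: measurable_funM => //.
  by apply: measurable_funX; exact: modulus_measurable.
have wi : mu2.-integrable (@plane_disk R) (EFin \o weight f).
  apply/integrableP; split; first exact/measurable_EFinP.
  rewrite (eq_integral (fun p => (weight f p)%:E))// => p /set_mem p1.
  by rewrite /= ger0_norm// weight_ge0.
have lim0 : {ae mu2, forall p, @plane_disk R p -> F ^~ p @ \oo --> (cst 0%E : plane -> \bar R) p}.
  apply/aeW => p p1; rewrite /F/=.
  have c : (fun n => modulus (p.1 +i* p.2) ^+ (2 * n.+1) * weight f p) @ \oo --> (0 * weight f p).
    apply: cvgMl.
    have q1 : `|modulus (p.1 +i* p.2) ^+ 2| < 1.
      by rewrite ger0_norm ?sqr_ge0// exprn_ilt1 ?modulus_ge0.
    have := cvg_expr q1.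
    rewrite -(cvg_shiftS (fun n => (modulus (p.1 +i* p.2) ^+ 2) ^+ n)).
    by under eq_fun do rewrite -exprM.
  by rewrite mul0r in c; apply: cvg_EFin c; exact: nearW.
have domF : {ae mu2, forall p n, @plane_disk R p -> (`|F n p| <= (EFin \o weight f) p)%E}.
  apply/aeW => p n p1; rewrite /F/= lee_fin.
  have w0 := weight_ge0 f p1.
  have mw0 : 0 <= modulus (p.1 +i* p.2) ^+ (2 * n.+1) * weight f p.
    by rewrite mulr_ge0// exprn_ge0// modulus_ge0.
  rewrite ger0_norm//.
  by rewrite ler_piMl// exprn_ile1 ?modulus_ge0// ltW.
have [_ _ H] := dominated_convergence mD mF (measurable_cst _) lim0 wi domF.
rewrite integral0 in H.
have [fin_near /cvgrPdist_lt/(_ _ e0) small_near] := (fine_cvgP _ _).1 H.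
have [N _ HN] := filterI fin_near small_near.
exists N; have [/= finN] := HN N (leqnn N).
rewrite sub0r normrN => lt_e; rewrite -(fineK finN) lte_fin.
exact: le_lt_trans (ler_norm _) lt_e.
Qed.

End tail.

(** * The space BMOA *)

Section bmoa.
Variable R : realType.
Implicit Types (f g : R[i] -> R[i]) (z w u c : R[i]).
Notation mR := (measurableTypeR R).
Notation plane := (mR * mR)%type.
Notation mu2 := ((@lebesgue_measure R) \x (@lebesgue_measure R))%E.

(** With w = z / c, each power w^(k+1) is within (k + 1) |w - 1| of 1. *)
Lemma log_poly_near c z N (eta : R) : modulus c = 1 -> modulus z <= 1 ->
  modulus (z - c) <= eta ->
  harmonic_sum R N - N%:R * eta <= modulus (log_poly c^-1 N).[z].
Proof.
move=> c1 z1 ze; have c0 : c != 0 by rewrite -modulus_eq0 c1 oner_eq0.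
rewrite horner_log_poly; set w := c^-1 * z.
have w1 : modulus w <= 1 by rewrite modulusM modulusV c1 invr1 mul1r.
have we : modulus (w - 1) <= eta.
  by rewrite -(mulVf c0) -mulrBr modulusM modulusV c1 invr1 mul1r.
have pow k : modulus (w ^+ k - 1) <= k%:R * eta.
  rewrite subrX1 modulusM mulrC; apply: ler_pM; rewrite ?modulus_ge0//.
  apply: le_trans (modulus_sum _ _) _.
  apply: (@le_trans _ _ (\sum_(i < k) 1)); last by rewrite sumr_const card_ord.
  by apply: ler_sum => i _; rewrite modulusX exprn_ile1 ?modulus_ge0.
have HE : modulus (\sum_(k < N) (k.+1%:R^-1 : R[i])) = harmonic_sum R N.
  rewrite (_ : \sum_(k < N) _ = (harmonic_sum R N)%:C).
    by rewrite modulusR ger0_norm// sumr_ge0.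
  by rewrite rmorph_sum; apply: eq_bigr => k _; rewrite fmorphV rmorph_nat.
rewrite -HE lerBlDr -lerBlDl; apply: le_trans (modulus_lowerB _ _) _.
rewrite -sumrB; apply: le_trans (modulus_sum _ _) _.
apply: (@le_trans _ _ (\sum_(k < N) eta)); last first.
  by rewrite sumr_const card_ord mulr_natl.
apply: ler_sum => k _; rewrite -[X in X - _]mul1r -mulrBl modulusM modulusV.
by rewrite modulus_nat ler_pdivrMr ?ltr0Sn// modulusB mulrC.
Qed.

Lemma sqrt_le_mul (a b c e : R) : 0 <= b -> a <= e -> 0 <= e ->
  Num.sqrt b <= c * Num.sqrt a -> b <= c ^+ 2 * e.
Proof.
move=> b0 ae e0 h; rewrite -[leLHS](sqr_sqrtr b0) -[e](sqr_sqrtr e0).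
rewrite -[c ^+ 2](real_normK (num_real c)) -exprMn.
rewrite lerXn2r ?nnegrE ?mulr_ge0 ?sqrtr_ge0//.
apply: le_trans h _; apply: (@le_trans _ _ (`|c| * Num.sqrt a)).
  by rewrite ler_wpM2r ?sqrtr_ge0// ler_norm.
by rewrite ler_wpM2l// ler_wsqrtr.
Qed.

Lemma mul_sqrt_le (a b c e : R) : 0 <= b -> e <= a -> 0 <= e -> 0 <= c ->
  c * Num.sqrt a <= Num.sqrt b -> c ^+ 2 * e <= b.
Proof.
move=> b0 ea e0 c0 h; rewrite -[leRHS](sqr_sqrtr b0) -[e](sqr_sqrtr e0) -exprMn.
rewrite lerXn2r ?nnegrE ?mulr_ge0 ?sqrtr_ge0//.
by apply: le_trans h; rewrite ler_wpM2l// ler_wsqrtr.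
Qed.

Lemma quadratic_beats_linear (x y k : R) : 1 <= x -> 0 <= y ->
  4 * (384 * y + 1) < x * k ->
  y * (2 * (64 * (x + 1 + 1))) + 1 < (x / 2) ^+ 2 * k.
Proof.
move=> x1 y0 h; have x0 : 0 < x by exact: lt_le_trans x1.
have yx : y <= y * x by rewrite ler_peMr.
move: h; rewrite -(ltr_pM2l x0) expr_div_n; lra.
Qed.

Lemma BMOA_fnorm f : f 0 = 0 ->
  fnorm (BMOA R) f = Num.sqrt (carleson_constant (mu_deriv f)).
Proof.
move=> f0.
change (modulus (f 0) + Num.sqrt (carleson_constant (mu_deriv f)) =
  Num.sqrt (carleson_constant (mu_deriv f))).
by rewrite f0 modulus0 add0r.
Qed.

(** A lower bound for T_g on the z^n yields k > 0 and, for each n, a box whose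
    measure |z|^(2n) |g'|^2 (1 - |z|^2) dA exceeds k l. The total mass of this
    measure tends to 0, which forces the arcs to be short. On a box over a
    sufficiently short arc the logarithm L with singularity on the arc is of size
    at least t/2, so that T_g L has Carleson constant at least k t^2 / 4, while
    boundedness of T_g only allows it to grow linearly in t. *)
Lemma BMOA_not_bounded_below g : analytic_on_disk g ->
  bounded_on (BMOA R) (Tg g) -> ~ bounded_below_on (BMOA R) (Tg g).
Proof.
move=> ga [Tc [M TM]] [c c0 below].
pose X n := horner ('X^n : {poly R[i]}); pose F n := Tg g (X n).
have Xc n : carrier (BMOA R) (X n) := carrier_BMOA_poly (carleson_Xn R n).
have Fc n : carrier (BMOA R) (F n) := Tc _ (Xc n).
have dT p z : carrier (BMOA R) (horner p) -> modulus z < 1 ->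
    derive1 (Tg g (horner p)) z = p.[z] * derive1 g z.
  by move=> pc z1; exact: derive1_Tg ga (@analytic_poly R p) (Tc _ pc).1 z1.
have weightT p (q : plane) : carrier (BMOA R) (horner p) ->
    modulus (q.1 +i* q.2) < 1 ->
    weight (Tg g (horner p)) q = modulus p.[q.1 +i* q.2] ^+ 2 * weight (F 0%N) q.
  move=> pc q1; rewrite /weight (dT _ _ pc q1) (dT _ _ (Xc 0%N) q1).
  by rewrite hornerXn expr0 mul1r modulusM exprMn mulrA.
have [C [C0 HC]] := (Fc 0%N).2.
have fin : (\int[mu2]_(p in @plane_disk R) (weight (F 0%N) p)%:E < +oo)%E.
  have [I Iarc box] := full_circle_box R.
  apply: le_lt_trans (ltry (C * (2 * pi))); apply: le_trans (HC _ _ Iarc).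
  rewrite mu_derivE; apply: le_integral_subset => p.
  - by move=> p1; split; [apply: box|]; apply/diskP.
  - by move=> p1; rewrite lee_fin weight_ge0//= lexx.
  - by move=> [_ /diskP p1]; rewrite lee_fin weight_ge0.
have Fz n : F n 0 = 0 by exact: Tg0.
have belowF n : c * fnorm (BMOA R) (X n) <= fnorm (BMOA R) (F n) := below _ (Xc n).
have wE n (p : plane) : modulus (p.1 +i* p.2) < 1 -> weight (F n) p =
    modulus (p.1 +i* p.2) ^+ (2 * n) * weight (F 0%N) p.
  by move=> p1; rewrite /F (weightT _ _ (Xc n) p1) hornerXn modulusX -exprM mulnC.
have Xz n : X n.+1 0 = 0 by rewrite /X hornerXn expr0n.
have Xlow n D : carleson_bound (mu_deriv (X n.+1)) D -> (256 * pi)^-1 <= D.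
  exact: BMOA_Xn_lower.
clearbody F X.
pose kappa : R := (256 * pi)^-1.
have kappa0 : 0 < kappa by rewrite invr_gt0 pmulr_rgt0 ?ltr0n// pi_gt0.
pose k := c ^+ 2 * kappa / 2.
have k0 : 0 < k by rewrite divr_gt0// mulr_gt0// exprn_gt0.
have kk : k < c ^+ 2 * kappa by move: k0; rewrite /k; move: (c ^+ 2 * kappa) => y; lra.
have notk n : ~ carleson_bound (mu_deriv (F n.+1)) k.
  move=> /carleson_constant_le; apply/negP; rewrite -ltNge.
  have h1 : kappa <= carleson_constant (mu_deriv (X n.+1)).
    by apply: le_carleson_constant; [exact: (Xc n.+1).2|exact: Xlow].
  have h2 := belowF n.+1; rewrite (BMOA_fnorm (Fz _)) (BMOA_fnorm (Xz _)) in h2.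
  have cF0 := carleson_constant_ge0 (Fc n.+1).2.
  exact: lt_le_trans kk (mul_sqrt_le cF0 h1 (ltW kappa0) (ltW c0) h2).
have small (del : R) : 0 < del -> exists I l, [/\ is_arc I l, l < del &
    ((k * l)%:E < mu_deriv (F 0%N) (carleson_box I l))%E].
  move=> del0; have e0 : 0 < k * del by rewrite mulr_gt0.
  have [n Hn] := weighted_tail_small (Fc 0%N).1 fin e0.
  have [I [l [Iarc HI]]] : exists I l, is_arc I l /\
      ((k * l)%:E < mu_deriv (F n.+1) (carleson_box I l))%E.
    apply: contrapT => H; apply: (notk n); split => // I l Il.
    by rewrite leNgt; apply/negP => h; apply: H; exists I, l.
  exists I, l; split; first exact: Iarc.
    rewrite -(ltr_pM2l k0) -lte_fin; apply: lt_trans HI _; apply: le_lt_trans Hn.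
    rewrite mu_derivE; apply: le_integral_subset => p.
    - by move=> [_ /diskP].
    - by move=> [_ /diskP p1]; rewrite (wE n.+1 p p1) lee_fin lexx andbT -(wE n.+1 p p1) weight_ge0.
    - by move=> p1; rewrite lee_fin -(wE n.+1 p p1) weight_ge0.
  apply: lt_le_trans HI _; rewrite !mu_derivE; apply: le_integral_subset => p.
  - exact: id.
  - move=> [_ /diskP p1]; rewrite !lee_fin; apply/andP; split.
      by rewrite (@weight_ge0 R (F n.+1) p p1).
    rewrite (wE n.+1 p p1); apply: (ler_piMl (weight_ge0 (F 0%N) p1)).
    exact: exprn_ile1 (modulus_ge0 _) (ltW p1).
  - by move=> [_ /diskP p1]; rewrite lee_fin weight_ge0.
have M20 : 0 <= M ^+ 2 by exact: sqr_ge0.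
pose Q := 4 * (384 * M ^+ 2 + 1) / k.
have Q0 : 0 < Q.
  apply: divr_gt0 k0; apply: mulr_gt0; first exact: ltr0n.
  exact: ltr_wpDl (mulr_ge0 (ler0n _ _) M20) ltr01.
have [t tQ] : exists t : nat, Q < t%:R.
  by exists (Num.bound Q); apply: archi_boundP; exact: ltW.
have t1 : 1 <= t%:R :> R.
  by have := lt_trans Q0 tQ; rewrite ltr0n ler1n.
pose m := t.+1; pose N := (2 ^ m)%N.
have N0 : 0 < N%:R :> R by rewrite ltr0n expn_gt0.
(* On a box over an arc of length l < del the logarithm is within N (3 l) <= 1/2 of the
   harmonic sum. *)
pose del : R := (6 * N%:R)^-1.
have del0 : 0 < del by rewrite invr_gt0 mulr_gt0.
have [I [l [Iarc ldel HI]]] := small del del0.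
have l0 : 0 < l by have [? [? [? []]]] := Iarc.
have [z0 z01 znear] := carleson_box_near Iarc.
pose u := z0^-1; have u1 : modulus u = 1 by rewrite modulusV z01 invr1.
pose L := log_poly u N.
have Lb := carleson_log_poly m u1.
have Lc : carrier (BMOA R) (horner L) := carrier_BMOA_poly Lb.
pose A : R := t%:R / 2.
have LA (p : plane) : carleson_box I l (p.1 +i* p.2) -> A <= modulus L.[p.1 +i* p.2].
  move=> Ip; have /andP[_ p1] := carleson_box_modulus Ip.
  apply: le_trans (log_poly_near N z01 (ltW p1) (znear _ Ip)).
  have h1 := harmonic_sum_pow2 R m; rewrite -/N in h1.
  have h2 : N%:R * (3 * l) <= 2^-1.
    have : l * (6 * N%:R) <= 1.
      rewrite -ler_pdivlMr ?mulr_gt0// div1r; exact: ltW.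
    by move: (N%:R) => nn; lra.
  move: h1 h2; rewrite /A /m -natr1; move: (harmonic_sum R N) (N%:R * _) => h y.
  lra.
have numeric : M ^+ 2 * (2 * (64 * m.+1%:R)) + 1 < A ^+ 2 * k.
  rewrite /A /m -[t.+2%:R]natr1 -[t.+1%:R]natr1; apply: (quadratic_beats_linear t1 M20).
  by rewrite -(ltr_pdivrMr _ _ k0).
pose T := Tg g (horner L).
have Tc' : carrier (BMOA R) T := Tc _ Lc.
have Tz : T 0 = 0 by exact: Tg0.
have TM' : fnorm (BMOA R) T <= M * fnorm (BMOA R) (horner L) := TM _ Lc.
have wT (p : plane) : modulus (p.1 +i* p.2) < 1 ->
    weight T p = modulus L.[p.1 +i* p.2] ^+ 2 * weight (F 0%N) p.
  by move=> p1; exact: (weightT L p Lc p1).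
clearbody T.
pose D : R := 2 * (64 * m.+1%:R).
have D0 : 0 <= D by rewrite !mulr_ge0.
have ccT : carleson_constant (mu_deriv T) <= M ^+ 2 * D.
  have cL := carleson_constant_le Lb.
  have cT0 := carleson_constant_ge0 Tc'.2.
  have h := TM'; rewrite (BMOA_fnorm Tz) (BMOA_fnorm (log_poly0 u N)) in h.
  exact: sqrt_le_mul cT0 cL D0 h.
have bT : carleson_bound (mu_deriv T) (M ^+ 2 * D + 1).
  by apply: (carleson_constant_lt Tc'.2); apply: le_lt_trans ccT _; rewrite ltrDl.
have A0 : 0 < A by rewrite divr_gt0// (lt_le_trans ltr01).
have A20 : 0 < A ^+ 2 by rewrite exprn_gt0.
have : ((A ^+ 2 * (k * l))%:E <= ((M ^+ 2 * D + 1) * l)%:E)%E.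
  apply: le_trans (bT.2 _ _ Iarc).
  apply: (@le_trans _ _ ((A ^+ 2)%:E * mu_deriv (F 0%N) (carleson_box I l))%E).
    by rewrite EFinM lee_pmul2l ?lte_fin// ltW.
  rewrite !mu_derivE.
  apply: le_trans (integral_scale_ge _ A20 _) _.
    by move=> p [_ /diskP p1]; exact: weight_ge0.
  apply: le_integral_subset => p.
  - exact: id.
  - move=> [Ip /diskP p1]; rewrite !lee_fin (wT _ p1).
    have w0 := weight_ge0 (F 0%N) p1; apply/andP; split.
      exact: mulr_ge0 (ltW A20) w0.
    apply: (ler_wpM2r w0); rewrite lerXn2r ?nnegrE ?(ltW A0) ?modulus_ge0//.
    exact: LA.
  - by move=> [_ /diskP p1]; rewrite lee_fin weight_ge0.
rewrite lee_fin mulrA ler_pM2r//; apply/negP; rewrite -ltNge.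
exact: numeric.
Qed.

End bmoa.

Theorem theorem3p3 (R : realType) (X : function_space R) (g : R[i] -> R[i])
    (hX : X = H2 R \/ X = Bloch R \/ X = BMOA R)
    (hg : analytic_on_disk g)
    (hTg : bounded_on X (Tg g)) :
  ~ bounded_below_on X (Tg g).
Proof.
case: hX hTg => [->|[->|->]] hTg.
- exact: H2_not_bounded_below.
- exact: bloch_not_bounded_below.
- exact: BMOA_not_bounded_below.
Qed.
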